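(* Let $p,p'$ be relatively prime positive integers with $p\ge3$ and $t=p'/p>2$. Then for all $1\le r\le p-1$ and $L\ge0$, $$\mathrm{ch}_q\,C^{(t)}_{L,r}=\sum_{m\ge0}\frac{q^{\frac{L^2}{4}+\frac L2}}{(q)_m}\,\mathrm{ch}_q\,C^{(t-1)}_{L-2m,r}.$$
   Context: Notation: $(q)_m=\prod_{j=1}^m(1-q^j)$; $[x]$ is the integer part of $x$. The following definitions are made for a fixed $p$ and a parameter $t=p'/p>1$ with $\gcd(p,p')=1$; the objects with superscript $(t-1)$ are the same with $p'$ replaced by $p'-p$. Weights. For $r,r',r''\in\{1,\dots,p-1\}$ with $r-r',r'-r''\in\{-1,1\}$: $w^{(t)}(r,r\pm1,r\pm2)=\frac t2$; $w^{(t)}(r,r+1,r)=2-\frac t2+[rt]-rt$ if $2\le r$, $r+1\le p-1$; $w^{(t)}(r,r-1,r)=1-\frac t2-[rt]+rt$ if $1\le r-1$, $r\le p-2$; $w^{(t)}(1,2,1)=w^{(t)}(p-1,p-2,p-1)=3-\frac{3t}{2}$. For $1\le r\le p-2$, $v^{(t)}(r)=1-w^{(t)}(r,r+1,r)-w^{(t)}(r+1,r,r+1)$ (an integer). Also $\Delta^{(t)}_{2,1}=\frac{3t-2}{4}$. Rigged paths. For $L\ge0$, a rigged path of length $L$ is a pair of integer sequences $P=((r_L,\dots,r_0),(\sigma_{L-1},\dots,\sigma_0))$ with $r_0=1$, $1\le r_i\le p-1$ for $0\le i\le L$, and $r_{i+1}-r_i\in\{-1,1\}$. It is admissible at level $t$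 if $\sigma_i\ge0$ for $0\le i\le L-1$, and $\sigma_i+\sigma_{i+1}\ge v^{(t)}(r)$ whenever $1\le i\le L-2$, $1\le r\le p-2$ and $r_{i-1},r_i,r_{i+1},r_{i+2}\in\{r,r+1\}$. $C^{(t)}_{L,r}$ is the set of rigged paths of length $L$ admissible at level $t$ with $r_L=r$ (empty for $L<0$). The degree is $$d(P)=L\Delta^{(t)}_{2,1}+\sum_{i=1}^{L-1}(L-i)\,w^{(t)}(r_{i+1},r_i,r_{i-1})+\sum_{i=0}^{L-1}(L-i)\sigma_i,$$ and $\mathrm{ch}_q\,C^{(t)}_{L,r}=\sum_{P\in C^{(t)}_{L,r}}q^{d(P)}$. *)

(* Defs.v *)
From HB Require Import structures.
From mathcomp Require Import all_boot all_order all_algebra.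
From mathcomp Require Import all_classical.

Set Implicit Arguments.
Unset Strict Implicit.
Unset Printing Implicit Defensive.

Import Order.TTheory GRing.Theory Num.Theory.
Local Open Scope classical_set_scope.
Local Open Scope ring_scope.

(** Formal series in q with rational exponents: [f e] is the coefficient of
    q^e.  The sums [\sum_(i \in A)] below are finitely supported sums
    (mathcomp's fsbigop, 0 on an infinite support).  Every series used here has
    its support in finitely many sets a + N, so for each exponent only finitely
    many summands are nonzero. *)
Definition qseries := rat -> int.

Definition qpow (a : rat) : qseries := fun e => (e == a)%:R.

Definition qmul (f g : qseries) : qseries :=
  fun e => \sum_(x \in [set: rat]) f x * g (e - x).

Definition qsum (I : choiceType) (A : set I) (F : I -> qseries) : qseries :=
  fun e => \sum_(i \in A) F i e.

(** (q)_m, with 'X in the role of q. *)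
Definition qpoch (m : nat) : {poly int} := \prod_(1 <= j < m.+1) (1 - 'X^j).

(** Coefficient of 'X^n in the power series 1/A = \sum_k (1 - A)^k, for a
    polynomial A with constant coefficient 1; the terms with k > n do not
    contribute. *)
Definition inv_coef (A : {poly int}) (n : nat) : int :=
  (\sum_(k < n.+1) (1 - A) ^+ k)`_n.

Definition qinv (A : {poly int}) : qseries :=
  qsum [set: nat] (fun n e => inv_coef A n * qpow n%:R e).

Lemma coef_expX0 (B : {poly int}) (k n : nat) :
  B`_0 = 0 -> (n < k)%N -> (B ^+ k)`_n = 0.
Proof.
move=> B0; elim: k n => [//|k IHk] n ltnk.
rewrite exprS coefM big1 // => -[[|i] /= lt_i] _; first by rewrite B0 mul0r.
by rewrite IHk ?mulr0 //; case: n ltnk lt_i => // n; rewrite subSS => *; 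
   apply: leq_ltn_trans (leq_subr _ _) _.
Qed.

Lemma inv_coefP (A : {poly int}) (n : nat) : A`_0 = 1 ->
  \sum_(i < n.+1) A`_i * inv_coef A (n - i) = (n == 0%N)%:R.
Proof.
move=> A0; have B0 : (1 - A)`_0 = 0 by rewrite coefB coef1 A0 subrr.
have invE j : (j <= n)%N ->
    inv_coef A j = (\sum_(k < n.+1) (1 - A) ^+ k)`_j.
  move=> lejn; rewrite /inv_coef !coef_sum -!(big_mkord xpredT
    (fun k => ((1 - A) ^+ k)`_j)) [RHS](big_cat_nat (n := j.+1)) //=.
  rewrite [X in _ = _ + X]big1_seq ?addr0 // => k.
  by rewrite mem_index_iota => /andP[_ /andP[ltjk _]]; apply: coef_expX0.
under eq_bigr => i _ do rewrite invE ?leq_subr //.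
rewrite -coefM; have {1}-> : A = - ((1 - A) - 1).
  by rewrite opprB opprB addrCA subrr addr0.
by rewrite mulNr -subrX1 opprB coefB coef_expX0 // subr0 coef1.
Qed.

Lemma qpoch_coef0 (m : nat) : (qpoch m)`_0 = 1.
Proof.
rewrite /qpoch -horner_coef0 horner_prod big_nat big1 // => j /andP[j0 _].
by rewrite !hornerE expr0n; case: j j0 => //= j _; rewrite subr0.
Qed.

(** The weight w^(t)(a, b, c), for a, b, c in {1, ..., p-1} with
    |a - b| = |b - c| = 1. *)
Definition weight (p : nat) (t : rat) (a b c : int) : rat :=
  if a != c then t / 2
  else if b == a + 1 then
    if a == 1 then 3 - 3 * t / 2
    else 2 - t / 2 + (Num.floor (a%:~R * t))%:~R - a%:~R * t
  else
    if a == p%:Z - 1 then 3 - 3 * t / 2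
    else 1 - t / 2 - (Num.floor (a%:~R * t))%:~R + a%:~R * t.

Definition vbound (p : nat) (t : rat) (r : int) : rat :=
  1 - weight p t r (r + 1) r - weight p t (r + 1) r (r + 1).

Definition Delta21 (t : rat) : rat := (3 * t - 2) / 4.

(** A pair ([:: r_0; ...; r_L], [:: sigma_0; ...; sigma_(L-1)]): the sequences
    are stored in order of increasing index. *)
Definition rpath := (seq int * seq int)%type.
Definition pr (P : rpath) (i : nat) : int := P.1`_i.
Definition psigma (P : rpath) (i : nat) : int := P.2`_i.

Definition is_rigged_path (p L : nat) (P : rpath) : Prop :=
  [/\ size P.1 = L.+1, size P.2 = L, pr P 0 = 1,
      forall i, (i <= L)%N -> 1 <= pr P i <= p%:Z - 1
    & forall i, (i < L)%N -> pr P i.+1 - pr P i \in [:: -1; 1]].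

Definition admissible (p : nat) (t : rat) (L : nat) (P : rpath) : Prop :=
  (forall i, (i < L)%N -> 0 <= psigma P i) /\
  (forall (i : nat) (r : int),
     (1 <= i)%N -> (i.+2 <= L)%N -> 1 <= r <= p%:Z - 2 ->
     (forall j, j \in [:: i.-1; i; i.+1; i.+2] -> pr P j \in [:: r; r + 1]) ->
     vbound p t r <= (psigma P i + psigma P i.+1)%:~R).

Definition Cset (p : nat) (t : rat) (L : int) (r : int) : set rpath :=
  match L with
  | Posz n => [set P | [/\ is_rigged_path p n P, admissible p t n P
                         & pr P n = r]]
  | Negz _ => set0
  end.

Definition degree (p : nat) (t : rat) (P : rpath) : rat :=
  let L := size P.2 in
  L%:R * Delta21 t
  + \sum_(1 <= i < L) (L - i)%:R * weight p t (pr P i.+1) (pr P i) (pr P i.-1)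
  + \sum_(0 <= i < L) (L - i)%:R * (psigma P i)%:~R.

Definition ch (p : nat) (t : rat) (L : int) (r : int) : qseries :=
  qsum (Cset p t L r) (fun P => qpow (degree p t P)).

(* Main.v *)
From HB Require Import structures.
Require Import Defs.
From mathcomp Require Import all_boot all_order all_algebra.
From mathcomp Require Import all_classical.
From mathcomp Require Import ring lra zify.

(** Read a rigged path from r_0 and cut it after a step a -> b.  Let F_L(a, b; k)
    be the generating series of what can follow when L - 1 steps remain, a turn
    straight back to a having to carry a rigging at least k; r_L stays fixed.
    The next step is either straight on or a turn, and raising its rigging by
    one multiplies a term by q^(L-1).  This gives a recursion in L (the record
    [transfer]) whose only parameters are the turn weights w(a, b) and the
    bounds v(a, b) on the sum of the riggings of two consecutive turns.

    The series of level t - 1, multiplied by q^(L(L-1)/4), satisfies the same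
    recursion, with the same weight t/2 for straight steps, the turn weights
    w(a, b) + c(a), and the bounds v' = v + 1 - c(a) - c(b), where c(a) = 2 if a
    is 1 or p - 1 and c(a) = 1 otherwise.  Call these series G_L(a, b; u), with
    u counted from the rigging c(a).  So level t - 1 describes the paths of
    level t in which turns are kept apart, and every path of level t arises from
    such a path by inserting m tight pairs of steps.  A pair has length 2 and
    moves through the path by unit steps of degree, whence a factor 1/(q)_m.  On
    series the insertion is the transform
      U^k(G)_L = sum_m q^(m(L+k) - m(m-1)) / (q)_m * G_(L-2m),
    and the assertion behind the theorem is
      F_L(a, b; c(a) + u) = U^(w(a,b) + c(a) + u - 2) (G(a, b; u))_L
    for 0 <= u <= v'(a, b).

    It is proved by induction on L without handling the pairs one by one.  The
    recursion 1/(q)_(m-1) = (1 - q^m)/(q)_m becomes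
      U^k(G)_L = U^(k+1)(G)_L + q^(L+k) U^k(G)_(L-2)          ([insertion_step]),
    and U commutes, up to a change of k, with multiplication by q^(aL) and with
    the shift of L.  These rules turn the recursion for G into the recursion for
    F in three situations: lowering u ([middle_step]), starting from u = v' at an
    inner node ([interior_step]), and at the nodes 1 and p - 1 ([end_step]).
    The exponents match because w(a, b) + w(b, a) = 1 - v(a, b) and, at an inner
    node b between a and d, w(b, a) + w(b, d) = 3 - t.

    Two points need care.  The bound v' can be -1; then no u is available and F
    is replaced by [even_run].  At an end node the assertion also holds for
    u = v' + 1, and there it is the theorem: a path from 1 has to step to 2, so
    it continues a virtual step 2 -> 1, followed by a turn whose rigging has
    been raised by v(2, 1), that is, by c(2) + v' + 1. *)

Set Implicit Arguments.
Unset Strict Implicit.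
Unset Printing Implicit Defensive.

Import Order.TTheory GRing.Theory Num.Theory.
Local Open Scope classical_set_scope.
Local Open Scope ring_scope.

(** * The ring of left-finite series *)

(** Below every exponent there are finitely many terms.  Such a support has a least
    element, so the product of two series involves finite sums only. *)
Definition left_finite (f : qseries) : Prop :=
  forall e, exists s : seq rat, forall x, x <= e -> f x != 0 -> x \in s.

(** The bound is minus the sum of the absolute values of the finitely many
    nonpositive exponents that occur. *)
Lemma left_finite_bounded (f : qseries) :
  left_finite f -> exists b, forall x, f x != 0 -> b <= x.
Proof.
move=> /(_ 0)[s fs]; exists (- \sum_(x <- s) `|x|) => x fx.
have [x0|/ltW x0] := leP x 0; last first.
  by apply: le_trans x0; rewrite oppr_le0 sumr_ge0.
rewrite lerNl; have xs := fs x x0 fx.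
rewrite (big_rem x) //= (le_trans (ler_norm _)) // normrN lerDl.
by rewrite sumr_ge0.
Qed.

Lemma fsum_seq (I : choiceType) (F : I -> int) (s : seq I) : uniq s ->
  (forall x, F x != 0 -> x \in s) -> \sum_(x \in [set: I]) F x = \sum_(x <- s) F x.
Proof.
move=> us Fs; rewrite [RHS]fsbig_seq //; apply/esym.
rewrite (fsbig_widen [set` s] setT) // => x [_ /= xs].
by apply: contra_notP xs => /eqP; apply: Fs.
Qed.

(** Since g vanishes below c, only the exponents of f up to e - c contribute; any
    list that contains these computes the coefficient. *)
Lemma qmul_seq (f g : qseries) (c e : rat) (s : seq rat) :
  (forall y, g y != 0 -> c <= y) -> uniq s ->
  (forall x, x <= e - c -> f x != 0 -> x \in s) ->
  qmul f g e = \sum_(x <- s) f x * g (e - x).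
Proof.
move=> gc us fs; apply: fsum_seq => // x; rewrite mulf_eq0 negb_or.
by case/andP=> fx /gc gx; apply: fs => //; lra.
Qed.

Lemma qmul_supp (f g : qseries) (e : rat) :
  qmul f g e != 0 -> exists2 x, f x != 0 & g (e - x) != 0.
Proof.
apply: contraPP => /forall2NP fg0; rewrite /qmul fsbig1 ?eqxx //.
move=> x _; have [/negP|/negP] := fg0 x; rewrite negbK => /eqP ->;
by rewrite ?mul0r ?mulr0.
Qed.

Lemma qmul_left_finite (f g : qseries) :
  left_finite f -> left_finite g -> left_finite (qmul f g).
Proof.
move=> ff gf e; have [b fb] := left_finite_bounded ff.
have [c gc] := left_finite_bounded gf.
have [[s fs] [r gr]] := (ff (e - c), gf (e - b)).
exists [seq x + y | x <- s, y <- r] => z ze /qmul_supp[x fx gx].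
apply/allpairsP; exists (x, z - x) => /=; split; last by rewrite subrKC.
  by apply: fs => //; have := gc _ gx; lra.
by apply: gr => //; have := fb _ fx; lra.
Qed.

Lemma qmulC (f g : qseries) : qmul f g = qmul g f.
Proof.
apply/funext => e; rewrite /qmul (reindex_fsbigT (fun x : rat => e - x)); last first.
  by exists (fun x => e - x) => x /=; rewrite subKr.
by apply: eq_fsbigr => x _; rewrite subKr mulrC.
Qed.

Lemma qmulDl (f g h : qseries) : left_finite f -> left_finite g -> left_finite h ->
  qmul (fun e => f e + g e) h = (fun e => qmul f h e + qmul g h e).
Proof.
move=> ff gf hf; apply/funext => e.
have [c hc] := left_finite_bounded hf.
have [[s fs] [r gr]] := (ff (e - c), gf (e - c)).
rewrite !(@qmul_seq _ _ c e (undup (s ++ r))) ?undup_uniq //.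
- by rewrite -big_split; apply: eq_bigr => x _; rewrite mulrDl.
- by move=> x xe gx; rewrite mem_undup mem_cat gr ?orbT.
- by move=> x xe gx; rewrite mem_undup mem_cat fs.
- move=> x xe gx; rewrite mem_undup mem_cat; apply/orP.
  have [fx|/negPn/eqP fx] := boolP (f x != 0); first by left; apply: fs.
  by right; apply: gr => //; rewrite fx add0r in gx.
Qed.

(** Both sides are the sum of f x * g y * h z over x + y + z = e.  One list s of
    exponents of f, namely those up to e - (c + d), serves all inner sums; the
    list W of values of x + y is then chosen large enough for every x in s. *)
Lemma qmulA (f g h : qseries) : left_finite f -> left_finite g -> left_finite h ->
  qmul f (qmul g h) = qmul (qmul f g) h.
Proof.
move=> ff gf hf; apply/funext => e.
have [c gc] := left_finite_bounded gf.
have [d hd] := left_finite_bounded hf.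
have [s0 fs0] := ff (e - (c + d)); pose s := undup s0.
have fs x : x <= e - (c + d) -> f x != 0 -> x \in s.
  by rewrite mem_undup; apply: fs0.
have [w fgw] := qmul_left_finite ff gf (e - d).
have [v gv] : exists v : seq rat, forall x y, x \in s -> y <= e - x - d ->
    g y != 0 -> x + y \in v.
  elim: (s) => [|x l [v vP]]; first by exists [::].
  have [u uP] := gf (e - x - d); exists ([seq x + y | y <- u] ++ v) => z y.
  rewrite inE => /predU1P[->|zl] ye gy; rewrite mem_cat.
    by rewrite map_f ?uP.
  by rewrite vP ?orbT.
pose W := undup (w ++ v).
rewrite (@qmul_seq _ _ (c + d) _ s) ?undup_uniq //; last first.
  by move=> y /qmul_supp[x /gc gx /hd hx]; lra.
rewrite (@qmul_seq _ _ d _ W) ?undup_uniq //; last first.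
  by move=> x xe fx; rewrite mem_undup mem_cat fgw.
transitivity (\sum_(z <- W) \sum_(x <- s) f x * g (z - x) * h (e - z)).
  rewrite exchange_big /=; apply: eq_big_seq => x xs.
  rewrite /qmul (reindex_fsbigT (fun z : rat => z - x)); last first.
    by exists (fun y => y + x) => y /=; rewrite ?subrK ?addrK.
  rewrite (@fsum_seq _ _ W) ?undup_uniq //.
    rewrite mulr_sumr; apply: eq_bigr => z _.
    by rewrite mulrA; congr (_ * h _); rewrite opprB addrA subrK.
  move=> z; rewrite mulf_eq0 negb_or => /andP[gz /hd hz].
  rewrite mem_undup mem_cat; apply/orP; right.
  by rewrite -(subrKC x z); apply: gv => //; lra.
apply: eq_bigr => z _; rewrite -mulr_suml.
have [->|/hd hz] := eqVneq (h (e - z)) 0; first by rewrite !mulr0.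
congr (_ * _); rewrite (@qmul_seq _ _ c _ s) ?undup_uniq //.
by move=> x xz; apply: fs; lra.
Qed.

Record lfseries := LFSeries { coef :> qseries; coef_left_finite : left_finite coef }.

Lemma lfseriesP (f g : lfseries) : (forall e, coef f e = coef g e) -> f = g.
Proof.
case: f g => [f ff] [g gf] /= /funext fg; case: _ / fg in gf *.
by congr LFSeries; apply: Prop_irrelevance.
Qed.

HB.instance Definition _ := gen_eqMixin lfseries.
HB.instance Definition _ := gen_choiceMixin lfseries.

Lemma left_finite0 : left_finite (fun=> 0).
Proof. by move=> e; exists [::] => x; rewrite eqxx. Qed.

Lemma left_finiteN (f : qseries) : left_finite f -> left_finite (fun e => - f e).
Proof. by move=> ff e; have [s fs] := ff e; exists s => x xe; rewrite oppr_eq0; apply: fs. Qed.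

Lemma left_finiteD (f g : qseries) :
  left_finite f -> left_finite g -> left_finite (fun e => f e + g e).
Proof.
move=> ff gf e; have [[s fs] [r gr]] := (ff e, gf e); exists (s ++ r) => x xe fgx.
rewrite mem_cat; apply/orP.
have [fx|/negPn/eqP fx] := boolP (f x != 0); first by left; apply: fs.
by right; apply: gr => //; rewrite fx add0r in fgx.
Qed.

Lemma left_finite_qpow (a : rat) : left_finite (qpow a).
Proof. by move=> e; exists [:: a] => x _; rewrite inE /qpow; case: (x == a). Qed.

Definition lf0 := LFSeries left_finite0.
Definition lfN (f : lfseries) := LFSeries (left_finiteN (@coef_left_finite f)).
Definition lfD (f g : lfseries) :=
  LFSeries (left_finiteD (@coef_left_finite f) (@coef_left_finite g)).
Definition lfM (f g : lfseries) :=
  LFSeries (qmul_left_finite (@coef_left_finite f) (@coef_left_finite g)).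
Definition q_ (a : rat) : lfseries := LFSeries (@left_finite_qpow a).

Fact lfDA : associative lfD.
Proof. by move=> f g h; apply: lfseriesP => e /=; rewrite addrA. Qed.
Fact lfDC : commutative lfD.
Proof. by move=> f g; apply: lfseriesP => e /=; rewrite addrC. Qed.
Fact lf0D : left_id lf0 lfD.
Proof. by move=> f; apply: lfseriesP => e /=; rewrite add0r. Qed.
Fact lfND : left_inverse lf0 lfN lfD.
Proof. by move=> f; apply: lfseriesP => e /=; rewrite addNr. Qed.

HB.instance Definition _ := GRing.isZmodule.Build lfseries lfDA lfDC lf0D lfND.

Lemma qmul_qpow (a : rat) (f : qseries) (e : rat) : qmul (qpow a) f e = f (e - a).
Proof.
rewrite /qmul (@fsum_seq _ _ [:: a]) ?big_seq1 //= ?/qpow ?eqxx ?mul1r //.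
by move=> x; rewrite inE; apply: contraR; rewrite /qpow => /negPf->; rewrite mul0r.
Qed.

Fact lfMA : associative lfM.
Proof.
by move=> f g h; apply: lfseriesP => e; rewrite /= qmulA //; apply: coef_left_finite.
Qed.
Fact lfMC : commutative lfM.
Proof. by move=> f g; apply: lfseriesP => e /=; rewrite qmulC. Qed.
Fact lf1M : left_id (q_ 0) lfM.
Proof. by move=> f; apply: lfseriesP => e /=; rewrite qmul_qpow subr0. Qed.
Fact lfMDl : left_distributive lfM lfD.
Proof.
by move=> f g h; apply: lfseriesP => e; rewrite /= qmulDl //; apply: coef_left_finite.
Qed.
Fact lf1_neq0 : q_ 0 != 0.
Proof. by apply/eqP => /(congr1 (fun f => coef f 0)) /=; rewrite /qpow eqxx. Qed.

HB.instance Definition _ :=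
  GRing.Zmodule_isComNzRing.Build lfseries lfMA lfMC lf1M lfMDl lf1_neq0.

Lemma lfcoefD (f g : lfseries) e : coef (f + g) e = coef f e + coef g e.
Proof. by []. Qed.
Lemma lfcoefM (f g : lfseries) : coef (f * g) = qmul f g.
Proof. by []. Qed.
Lemma lfcoef0 e : coef 0 e = 0.
Proof. by []. Qed.
Lemma lfcoef_sum (I : Type) (s : seq I) (F : I -> lfseries) e :
  coef (\sum_(i <- s) F i) e = \sum_(i <- s) coef (F i) e.
Proof. exact: (big_morph (fun f : lfseries => coef f e)). Qed.

Lemma lfcoef_qM (a : rat) (f : lfseries) e : coef (q_ a * f) e = coef f (e - a).
Proof. by rewrite lfcoefM qmul_qpow. Qed.

Lemma q0 : q_ 0 = 1. Proof. by []. Qed.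
Lemma qD (a b : rat) : q_ (a + b) = q_ a * q_ b.
Proof.
apply: lfseriesP => e; rewrite lfcoef_qM /= /qpow; congr (_%:R); congr nat_of_bool.
by apply/eqP/eqP => H; lra.
Qed.
Lemma qX (n : nat) : q_ n%:R = q_ 1 ^+ n.
Proof. by elim: n => [|n IHn]; rewrite ?expr0 // exprS -IHn -qD -natr1 addrC. Qed.

(** A series fixed by a positive shift vanishes, since its support has a least
    element. *)
Lemma mul1Bq_eq0 (a : rat) (f : lfseries) : 0 < a -> (1 - q_ a) * f = 0 -> f = 0.
Proof.
move=> a0 fa; have [b fb] := left_finite_bounded (@coef_left_finite f).
have shift e : coef f e = coef f (e - a).
  have /eqP := fa; rewrite mulrBl mul1r subr_eq0 => /eqP {1}->.
  by rewrite lfcoef_qM.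
apply: lfseriesP => e; rewrite lfcoef0.
have iter_shift n : coef f e = coef f (e - a * n%:R).
  elim: n => [|n ->]; first by rewrite mulr0 subr0.
  by rewrite shift; congr (coef f _); rewrite -natr1; ring.
have [n ltn] : exists n : nat, (e - b) / a < n%:R.
  by exists (Num.truncn ((e - b) / a)).+1; apply: truncnS_gt.
apply/eqP; apply: contraT; rewrite (iter_shift n) => /fb.
by rewrite ltr_pdivrMr // mulrC in ltn; lra.
Qed.

Lemma mul1Bq_inj (a : rat) (f g : lfseries) :
  0 < a -> (1 - q_ a) * f = (1 - q_ a) * g -> f = g.
Proof.
move=> a0 fg; apply/eqP; rewrite -subr_eq0; apply/eqP.
by apply: (mul1Bq_eq0 a0); rewrite mulrBr fg subrr.
Qed.

(** * Inverses of polynomials in q *)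

Lemma qinvE (A : {poly int}) (e : rat) :
  qinv A e = if e \is a Num.nat then inv_coef A (Num.truncn e) else 0.
Proof.
rewrite /qinv /qsum; case: ifPn => [/natrP[n ->]|eN].
  rewrite (@fsum_seq _ _ [:: n]) ?big_seq1 //= /qpow ?natrK ?eqxx ?mulr1 //.
  by move=> k; rewrite inE; apply: contraR; rewrite eqr_nat eq_sym => /negPf->; rewrite mulr0.
rewrite fsbig1 // => n _; rewrite /qpow; case: eqVneq => [en|]; last by rewrite mulr0.
by rewrite en natr_nat in eN.
Qed.

Lemma qinv_left_finite (A : {poly int}) : left_finite (qinv A).
Proof.
move=> e; exists [seq n%:R | n <- iota 0 (Num.truncn e).+1] => x xe.
rewrite qinvE; case: ifP => // /natrP[n xn] _; rewrite xn map_f // mem_iota add0n.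
by rewrite -(ltr_nat rat) -xn (le_lt_trans xe) ?truncnS_gt.
Qed.

Definition lfinv (A : {poly int}) : lfseries := LFSeries (@qinv_left_finite A).

(** Substitution of q for the variable. *)
Definition lfpoly (A : {poly int}) : lfseries := (map_poly intr A).[q_ 1].

Lemma lfpolyE (A : {poly int}) : lfpoly A = \sum_(i < size A) q_ i%:R *~ A`_i.
Proof.
rewrite /lfpoly (@horner_coef_wide _ (size A)) ?size_poly //.
by apply: eq_bigr => i _; rewrite coef_map /= qX mulrzl.
Qed.

Lemma lfcoefMz (f : lfseries) (n : int) e : coef (f *~ n) e = coef f e * n.
Proof.
have lfcoefMn k : coef (f *+ k) e = coef f e *+ k.
  by elim: k => [|k IHk] //; rewrite !mulrS lfcoefD IHk.
rewrite -mulrzz; case: n => n; first exact: lfcoefMn.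
by rewrite -[RHS]/(- (coef f e *+ n.+1)) -lfcoefMn.
Qed.

(** The product formula for [inv_coef], read off coefficient by coefficient: the
    sum runs over the size of A here and up to n there, and the terms in between
    vanish. *)
Lemma lfpolyV (A : {poly int}) : A`_0 = 1 -> lfpoly A * lfinv A = 1.
Proof.
move=> A0; apply: lfseriesP => e; rewrite lfpolyE mulr_suml lfcoef_sum.
under eq_bigr => i _ do rewrite mulrzAl lfcoefMz lfcoef_qM /= qinvE.
rewrite [RHS]/= /qpow.
have [/natrP[n ->]|eN] := boolP (e \is a Num.nat); last first.
  have -> : (e == 0) = false by apply: contraNF eN => /eqP->; exact: (natr_nat _ 0).
  rewrite big1 // => i _.
  have /negPf-> : e - i%:R \isn't a Num.nat; last by rewrite mul0r.
  apply: contraNN eN => /natrP[k ek].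
  by rewrite -(subrK i%:R e) ek -natrD natr_nat.
rewrite -[n%:R == 0]/(n%:R == 0%N%:R) eqr_nat -(inv_coefP n A0).
have term i : (if n%:R - i%:R \is a @Num.nat rat
    then inv_coef A (Num.truncn (n%:R - i%:R : rat)) else 0) * A`_i
    = (i < n.+1)%N%:R * (A`_i * inv_coef A (n - i)).
  have [le_in|lt_ni] := leqP i n.
    by rewrite -natrB // natr_nat natrK ltnS le_in mul1r mulrC.
  rewrite ltnNge lt_ni /= mul0r ifF ?mul0r //; apply/negP => /natr_ge0.
  by rewrite subr_ge0 ler_nat leqNgt lt_ni.
under eq_bigr => i _ do rewrite term.
rewrite -(big_mkord xpredT (fun i => (i < n.+1)%N%:R * (A`_i * inv_coef A (n - i)))).
rewrite -(big_mkord xpredT (fun i => A`_i * inv_coef A (n - i))).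
have [le_nA|lt_An] := leqP n.+1 (size A).
  rewrite (big_cat_nat (n := n.+1)) //= [X in _ + X]big1_seq ?addr0.
    by apply: eq_big_nat => i /andP[_ ->]; rewrite mul1r.
  by move=> i; rewrite mem_index_iota => /andP[_ /andP[ni _]]; rewrite ltnNge ni mul0r.
rewrite [RHS](big_cat_nat (n := size A)) //= ?(ltnW lt_An) //.
rewrite [X in _ = _ + X]big1_seq ?addr0.
  by apply: eq_big_nat => i /andP[_ iA]; rewrite (ltn_trans iA) ?mul1r.
by move=> i; rewrite mem_index_iota => /andP[_ /andP[Ai _]]; rewrite nth_default ?mul0r.
Qed.

Lemma lfpoly_qpoch (m : nat) :
  lfpoly (qpoch m) = \prod_(1 <= j < m.+1) (1 - q_ j%:R).
Proof.
rewrite /lfpoly /qpoch rmorph_prod /= horner_prod; apply: eq_bigr => j _.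
by rewrite rmorphB /= rmorph1 map_polyXn !hornerE qX.
Qed.

Definition qpochV (m : nat) : lfseries := lfinv (qpoch m).

Lemma qpochV0 : qpochV 0 = 1.
Proof.
by have := lfpolyV (qpoch_coef0 0); rewrite lfpoly_qpoch big_geq // mul1r.
Qed.

Lemma qpochVS (m : nat) : (1 - q_ m.+1%:R) * qpochV m.+1 = qpochV m.
Proof.
have e1 : lfpoly (qpoch m) * qpochV m = 1 := lfpolyV (qpoch_coef0 m).
have : lfpoly (qpoch m.+1) * qpochV m.+1 = 1 := lfpolyV (qpoch_coef0 m.+1).
rewrite !lfpoly_qpoch big_nat_recr //= -lfpoly_qpoch => e2.
by rewrite -[LHS]mulr1 -[X in _ * X]e1 -[RHS]mulr1 -[X in _ = _ * X]e2; ring.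
Qed.

(** * The insertion transform *)

(** What the recursions use: powers of q with rational exponents, the possibility
    to cancel 1 - q^(n+1), and elements [qfactV m] in the role of 1/(q)_m. *)
Record q_system (R : comNzRingType) := QSystem {
  qexp :> rat -> R;
  qexp0 : qexp 0 = 1;
  qexpD : forall a b, qexp (a + b) = qexp a * qexp b;
  qexp_inj : forall n (f g : R),
    (1 - qexp n.+1%:R) * f = (1 - qexp n.+1%:R) * g -> f = g;
  qfactV : nat -> R;
  qfactV0 : qfactV 0 = 1;
  qfactVS : forall m, (1 - qexp m.+1%:R) * qfactV m.+1 = qfactV m }.

Section Transform.
Variables (R : comNzRingType) (q : q_system R).
Implicit Types (G H A B : nat -> R).

Definition insertion_coef (m : nat) : R := q (- (m%:R * (m%:R - 1))) * qfactV q m.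

(** Insertion of m pairs into an object of length L - 2m.  The truncated
    subtraction is harmless: all sequences below vanish at 0. *)
Definition insertion (k : rat) (G : nat -> R) (L : nat) : R :=
  \sum_(m < L.+1) insertion_coef m * q (m%:R * (L%:R + k)) * G (L - m.*2)%N.

(** A contribution a to the first exponent is counted once for each of the n - 1
    remaining steps. *)
Definition step_power (a : rat) (n : nat) : R := q (a * (n%:R - 1)).

Local Notation U := insertion.
Local Notation Y := step_power.

Lemma step_powerD a b n : Y (a + b) n = Y a n * Y b n.
Proof. by rewrite /step_power mulrDl qexpD. Qed.

Lemma step_power0 n : Y 0 n = 1.
Proof. by rewrite /step_power mul0r qexp0. Qed.

Lemma step_power_at1 a : Y a 1 = 1.
Proof. by rewrite /step_power subrr mulr0 qexp0. Qed.

Lemma step_power_inj n (f g : R) : (1 - Y 1 n.+2) * f = (1 - Y 1 n.+2) * g -> f = g.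
Proof. by rewrite /step_power mul1r -[n.+2%:R]natr1 addrK; apply: qexp_inj. Qed.

Lemma insertion_wide k G L N : G 0 = 0 -> (L < N)%N ->
  U k G L = \sum_(m < N) insertion_coef m * q (m%:R * (L%:R + k)) * G (L - m.*2)%N.
Proof.
move=> G0 ltLN; pose F m := insertion_coef m * q (m%:R * (L%:R + k)) * G (L - m.*2)%N.
rewrite /insertion -(big_mkord xpredT F) -[RHS](big_mkord xpredT F).
rewrite [RHS](big_cat_nat (n := L.+1)) //= [X in _ + X]big1_seq ?addr0 // => m.
rewrite mem_index_iota => /andP[_ /andP[ltLm _]].
rewrite /F (_ : L - m.*2 = 0)%N ?G0 ?mulr0 //; lia.
Qed.

Lemma eq_insertion k G H L : (forall n, G n = H n) -> U k G L = U k H L.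
Proof. by move=> GH; apply: eq_bigr => m _; rewrite GH. Qed.

Lemma insertionD k G H L : U k (fun n => G n + H n) L = U k G L + U k H L.
Proof. by rewrite -big_split; apply: eq_bigr => m _; rewrite mulrDr. Qed.

Lemma insertion_at1 k G : G 0 = 0 -> U k G 1 = G 1.
Proof.
move=> G0; rewrite /insertion !big_ord_recl big_ord0 /= G0 mulr0 !addr0.
by rewrite /insertion_coef qfactV0 !mul0r oppr0 qexp0 !mul1r.
Qed.

(** The difference of the two transforms at N + 2 has the factor 1 - q^m, which
    lowers 1/(q)_m to 1/(q)_(m-1); reindexing m gives the transform at N. *)
Lemma insertion_step k k' e G N : G 0 = 0 -> k' = k + 1 -> e = N%:R + 2 + k ->
  U k G N.+2 = U k' G N.+2 + q e * U k G N.
Proof.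
move=> G0 -> ->; apply/eqP; rewrite addrC -subr_eq; apply/eqP.
rewrite -sumrB big_ord_recl /= !mul0r subrr add0r (@insertion_wide k G N N.+2) // mulr_sumr.
apply: eq_bigr => m _; rewrite /bump /= add1n doubleS subSS -mulrBl [RHS]mulrA.
have {1}-> : (N.+1 - m.*2.+1 = N - m.*2)%N by rewrite subSS.
apply: (congr1 ( *%R^~ (G (N - m.*2)%N))); rewrite /insertion_coef -(qfactVS q m).
rewrite -[N.+2%:R]natr1 -[N.+1%:R]natr1 -[m.+1%:R]natr1.
set n := N%:R; set i := m%:R.
rewrite (_ : (i + 1) * (n + 1 + 1 + (k + 1)) = (i + 1) * (n + 1 + 1 + k) + (i + 1)); last by ring.
rewrite (_ : (i + 1) * (n + 1 + 1 + k) = 2 * i + (n + 2 + k + i * (n + k))); last by ring.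
rewrite (_ : - (i * (i - 1)) = - ((i + 1) * (i + 1 - 1)) + 2 * i); last by ring.
by rewrite !qexpD; ring.
Qed.

Lemma insertion_q k a G L : G 0 = 0 ->
  q (a * L%:R) * U k G L = U (k + 2 * a) (fun n => q (a * n%:R) * G n) L.
Proof.
move=> G0; rewrite mulr_sumr; apply: eq_bigr => m _.
have [le_2m|lt_2m] := leqP m.*2 L; last first.
  by rewrite (_ : L - m.*2 = 0)%N ?G0 ?mulr0 //; lia.
rewrite natrB // -muln2 natrM.
set n := L%:R; set i := m%:R.
rewrite (_ : i * (n + (k + 2 * a)) = i * (n + k) + 2 * a * i); last by ring.
rewrite (_ : a * n = 2 * a * i + a * (n - i * 2)); last by ring.
by rewrite !qexpD; ring.
Qed.

Lemma insertion_power k k' a G L : G 0 = 0 -> k' = k + 2 * a ->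
  Y a L * U k G L = U k' (fun n => Y a n * G n) L.
Proof.
move=> G0 ->; have YE n : Y a n = q (- a) * q (a * n%:R).
  by rewrite -qexpD; congr (q _); ring.
rewrite YE -mulrA insertion_q // mulr_sumr; apply: eq_bigr => m _.
by rewrite YE; ring.
Qed.

Lemma insertion_pred k G L : G 0 = 0 -> U k G L = U (k - 1) (fun n => G n.-1) L.+1.
Proof.
move=> G0; rewrite (@insertion_wide k G L L.+2) //; apply: eq_bigr => m _.
rewrite (_ : (L.+1 - m.*2).-1 = (L - m.*2)%N); last by lia.
by rewrite (_ : L.+1%:R + (k - 1) = L%:R + k) // -natr1; ring.
Qed.

Lemma insertion_pred_power k k' a G L : G 0 = 0 -> k' = k - 1 + 2 * a ->
  Y a L.+1 * U k G L = U k' (fun n => Y a n * G n.-1) L.+1.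
Proof. by move=> G0 kE; rewrite insertion_pred // (@insertion_power _ k'). Qed.

(** H and its companion Hs belong to the reversed edge, whose recursion leads back
    to Gs at length N; [insertion_step] absorbs this term. *)
Lemma middle_step (xi eta : rat) (G Gs H Hs : nat -> R) N :
  eta = 1 - xi -> Gs 0 = 0 -> H 0 = 0 ->
  (forall n, G n = Gs n + Y xi n * H n.-1) ->
  (forall n, Hs n = H n + Y eta n * Gs n.-1) ->
  U (xi - 1) Gs N.+2 + Y xi N.+2 * U (eta - 2) Hs N.+1 = U (xi - 2) G N.+2.
Proof.
move=> -> Gs0 H0 GE HE; rewrite (eq_insertion _ _ GE) (eq_insertion _ _ HE) !insertionD mulrDr.
rewrite (@insertion_pred_power _ (xi - 2)) //; last by ring.
rewrite -(@insertion_pred_power (xi - 2) _ _ Gs) //; last by ring.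
rewrite (@insertion_step (xi - 2) (xi - 1) (xi * (N%:R + 1) + (1 - xi) * N%:R) Gs) //; [|ring|ring].
rewrite qexpD mulrA /step_power -!natr1 !addrK. ring.
Qed.

(** G and G' are the series of the two edges that enter the same inner node from
    opposite sides, B and A those of the two edges that leave it.  After
    cancellation of the terms common to both sides, what remains at length N is
    a relation between G and G' alone ([G'E] in the proof), valid because both
    are combinations of A and B.  The flags e and e' mark the edges with bound
    -1, for which some exponents move by one. *)
Lemma interior_step (g h tau : rat) (e e' : bool) (A B G G' : nat -> R)
    (X : R) N :
  h = 5 - g - 2 * tau ->
  A 0 = 0 -> B 0 = 0 -> G 0 = 0 -> G' 0 = 0 -> G' 1 = G 1 ->
  (forall n, (1 - Y 1 n) * G n = Y tau n * B n.-1 + Y (2 - g + e%:R) n * A n.-1) ->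
  (forall n, (1 - Y 1 n) * G' n = Y tau n * A n.-1 + Y (2 - h + e'%:R) n * B n.-1) ->
  (1 - Y 1 N.+2) * X =
    Y tau N.+2 * (U (h - 2 - e'%:R) B N.+1 + Y (h - 1) N.+1 * U (- h) G' N)
    + Y (2 - g) N.+2 *
      (Y e%:R N.+2 * U (g - 2 - e%:R) A N.+1 + Y (g - 1) N.+1 * U (- g) G N) ->
  X = U (- g) G N.+2.
Proof.
move=> -> A0 B0 G0 G'0 G1 HG HG' HX; apply: (@step_power_inj N); rewrite {}HX.
pose At n := Y (2 - g + e%:R) n * A n.-1; pose Bt n := Y tau n * B n.-1.
pose yG n := Y 1 n * G n.
have [At0 Bt0 yG0] : [/\ At 0 = 0, Bt 0 = 0 & yG 0 = 0].
  by rewrite /At /Bt /yG A0 B0 G0 !mulr0.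
have GE n : G n = yG n + (Bt n + At n) by rewrite -[Bt n + At n]HG /yG; ring.
have G'E n : Y (3 - g - tau) n * G' n =
    (if e then At n else 0) + (if e' then 0 else Bt n) + yG n.
  case: n => [|[|n]].
  - by rewrite G'0 At0 Bt0 yG0 mulr0 !addr0 !if_same addr0.
  - by rewrite /At /Bt /yG /= A0 B0 G1 !mulr0 !if_same !add0r !step_power_at1.
  apply: (@step_power_inj n); rewrite mulrCA HG' !mulrDr (mulrCA _ (Y 1 _)) HG.
  rewrite /At /Bt /= ![Y _ _ * (Y _ _ * _)]mulrA -!step_powerD.
  rewrite (_ : 3 - g - tau + tau = 1 + (2 - g)); last by ring.
  rewrite (_ : 3 - g - tau + _ = tau + e'%:R); last by ring.
  by case: (e); case: (e'); rewrite /= !step_powerD ?step_power0; ring.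
(* Move every power of q inside a transform, at length N + 2 and then at N. *)
rewrite mulrBl mul1r (@insertion_power _ (2 - g)) //; last by ring.
rewrite -/yG (eq_insertion _ _ GE) !insertionD.
rewrite [Y tau _ * _]mulrDr (@insertion_pred_power _ (2 - g - e'%:R)) //; last by ring.
rewrite -/Bt [Y (2 - g) _ * _]mulrDr !mulrA -step_powerD.
rewrite (@insertion_pred_power _ (1 - g + e%:R) (2 - g + e%:R)) //; last by ring.
rewrite -/At.
have -> : Y (2 - g) N.+2 * Y (g - 1) N.+1 = q (N%:R + 2 - g).
  by rewrite /step_power -qexpD -[N.+2%:R]natr1 -[N.+1%:R]natr1; congr (q _); ring.
have -> : Y tau N.+2 * Y (5 - g - 2 * tau - 1) N.+1 * U (- (5 - g - 2 * tau)) G' N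
    = q (N%:R + 2 + (1 - g)) * ((if e then U (1 - g) At N else 0)
        + (if e' then 0 else U (1 - g) Bt N) + U (1 - g) yG N).
  rewrite (_ : Y tau _ * _ = q (N%:R + 2 + (1 - g)) * Y (3 - g - tau) N); last first.
    by rewrite /step_power -!qexpD -[N.+2%:R]natr1 -[N.+1%:R]natr1; congr (q _); ring.
  rewrite -mulrA (@insertion_power _ (1 - g)) //; last by ring.
  rewrite (eq_insertion _ _ G'E) !insertionD; congr (_ * (_ + _ + _)).
    by case: (e) => //; rewrite /insertion big1 // => m _; rewrite mulr0.
  by case: (e') => //; rewrite /insertion big1 // => m _; rewrite mulr0.
have two F : F 0 = 0 -> U (- g) F N.+2 = U (1 - g) F N.+2 + q (N%:R + 2 - g) * U (- g) F N.
  by move=> F0; apply: insertion_step => //; ring.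
have one F : F 0 = 0 ->
    U (1 - g) F N.+2 = U (2 - g) F N.+2 + q (N%:R + 2 + (1 - g)) * U (1 - g) F N.
  by move=> F0; apply: insertion_step => //; ring.
rewrite (eq_insertion _ _ GE) !insertionD (two yG) // (two At) // (two Bt) //.
rewrite (one yG) // (one Bt) //.
case: (e); case: (e') => /=; rewrite ?subr0 ?addr0.
- rewrite (one At) // (_ : 2 - g - 1 = 1 - g); last by ring.
  by rewrite (one Bt) // (_ : 1 - g + 1 = 2 - g); last (by ring); ring.
- rewrite (one At) // (_ : 1 - g + 1 = 2 - g); last by ring.
  by ring.
- rewrite (_ : 2 - g - 1 = 1 - g); last by ring.
  by rewrite (one Bt) //; ring.
- by ring.
Qed.

(** At an end node there is no straight step, so G is a multiple of A alone.  But
    the reversed edge admits one more rigging there, which brings in the series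
    H of the turns with rigging beyond v'; H and P are determined together. *)
Lemma end_step (g : rat) (e : bool) (A G Gh : nat -> R) (P H : R) N :
  A 0 = 0 -> G 0 = 0 ->
  (forall n, (1 - Y 1 n) * G n = Y (2 - g + e%:R) n * A n.-1) ->
  (forall n, Gh n = if e then G n else Y 1 n * G n) ->
  (1 - Y 1 N.+2) * H =
    Y (3 - g) N.+2 * (U (g - 2 - e%:R) A N.+1 + Y (g - 1) N.+1 * U (- g) G N
                      + Y (g - 2) N.+1 * U (1 - g) Gh N) ->
  P = H + (if e then 0 else Y (2 - g) N.+2 * U (g - 2) A N.+1)
        + Y (2 - g) N.+2 * Y (g - 1) N.+1 * U (- g) G N ->
  H = U (1 - g) Gh N.+2 /\ P = U (- g) G N.+2.
Proof.
move=> A0 G0 HG GhE HH ->; pose At a n := Y (a - g) n * A n.-1.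
have At0 a : At a 0 = 0 by rewrite /At A0 mulr0.
have Gh0 : Gh 0 = 0 by rewrite GhE G0 mulr0 if_same.
have GhA n : Gh n = At 3 n + Y 1 n * Gh n.
  rewrite /At (_ : 3 - g = (1 - e%:R) + (2 - g + e%:R)); last by ring.
  rewrite step_powerD -mulrA -HG GhE.
  by case: (e); rewrite ?subrr ?subr0 ?step_power0; ring.
have YGh n : Y 1 n * G n = (if e then 0 else At 3 n) + Y 1 n * Gh n.
  rewrite {1}/At GhE; case: (e) HG => HG; first by rewrite add0r.
  rewrite (_ : 3 - g = 1 + (2 - g + false%:R)); last by rewrite /=; ring.
  by rewrite step_powerD -mulrA -HG; ring.
have exps : Y (2 - g) N.+2 * Y (g - 1) N.+1 = q (N%:R + 2 - g).
  by rewrite /step_power -qexpD -[N.+2%:R]natr1 -[N.+1%:R]natr1; congr (q _); ring.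
have HE : H = U (1 - g) Gh N.+2.
  apply: (@step_power_inj N); rewrite {}HH 2!mulrDr !mulrA.
  rewrite (@insertion_pred_power _ (3 - g - e%:R)) //; last by ring.
  rewrite [RHS]mulrBl mul1r (@insertion_power _ (3 - g)) //; last by ring.
  rewrite (_ : Y (3 - g) N.+2 * Y (g - 2) N.+1 = q (N%:R + 2 + (1 - g))); last first.
    by rewrite /step_power -qexpD -[N.+2%:R]natr1 -[N.+1%:R]natr1; congr (q _); ring.
  rewrite (_ : Y (3 - g) N.+2 * Y (g - 1) N.+1 = q (N%:R + 2 + (2 - g)) * Y 1 N); last first.
    by rewrite /step_power -!qexpD -[N.+2%:R]natr1 -[N.+1%:R]natr1; congr (q _); ring.
  rewrite -[_ * Y 1 N * _]mulrA (@insertion_power _ (2 - g)) //; last by ring.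
  rewrite (eq_insertion _ _ YGh) (eq_insertion _ N GhA) (eq_insertion _ N.+2 GhA).
  rewrite !insertionD -/(At 3).
  pose yGh n := Y 1 n * Gh n; rewrite -![fun n => Y 1 n * Gh n]/yGh.
  have yGh0 : yGh 0 = 0 by rewrite /yGh Gh0 mulr0.
  have one F : F 0 = 0 ->
      U (1 - g) F N.+2 = U (2 - g) F N.+2 + q (N%:R + 2 + (1 - g)) * U (1 - g) F N.
    by move=> F0; apply: insertion_step => //; ring.
  have two F : F 0 = 0 ->
      U (2 - g) F N.+2 = U (3 - g) F N.+2 + q (N%:R + 2 + (2 - g)) * U (2 - g) F N.
    by move=> F0; apply: insertion_step => //; ring.
  rewrite !(one (At 3)) // !(one yGh) // !(two yGh) //.
  rewrite (_ : U (2 - g) (fun n => if e then 0 else At 3 n) N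
             = if e then 0 else U (2 - g) (At 3) N); last first.
    by case: (e) => //; rewrite /insertion big1 // => m _; rewrite mulr0.
  case: (e); rewrite ?subr0 /=.
    by rewrite (_ : 3 - g - 1 = 2 - g); last (by ring); ring.
  by rewrite (two (At 3)) //; ring.
split=> //; rewrite HE exps (@insertion_step (- g) (1 - g) (N%:R + 2 - g) G N) //; try ring.
congr (_ + _); rewrite (eq_insertion _ _ GhE).
case: (e) HG => HG; first by rewrite addr0.
have GE n : G n = Y 1 n * G n + At 2 n.
  by rewrite /At -[2 - g]addr0 -[0]/(false%:R : rat) -HG; ring.
rewrite [RHS](eq_insertion _ _ GE) insertionD; congr (_ + _).
by rewrite (@insertion_pred_power _ (1 - g)) //; ring.
Qed.

End Transform.

(** * Transfer systems *)

Definition node (p : nat) (a : int) : bool := 1 <= a <= p%:Z - 1.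
Definition edge (p : nat) (a b : int) : bool :=
  [&& node p a, node p b & (b == a + 1) || (b == a - 1)].
Definition is_end (p : nat) (a : int) : bool := (a == 1) || (a == p%:Z - 1).
(** How much the weight of a turn a, b, a drops, besides the overall shift by 1/2
    of all weights, when the level goes up by one. *)
Definition turn_drop (p : nat) (a : int) : int := if is_end p a then 2 else 1.

Lemma edgeC p a b : edge p a b = edge p b a.
Proof. by rewrite /edge; apply/idP/idP => /and3P[-> ->] /=; lia. Qed.

Lemma edge_next p a b : edge p a b -> ~~ is_end p b -> edge p b (2 * b - a).
Proof. by rewrite /edge /node /is_end; lia. Qed.

(** [F L a b k] counts the continuations of a step a -> b, with L - 1 steps left.
    In [tr_turn] the turns with rigging exactly k are split off; they leave the
    bound v - k for the next turn.  From rigging v on there is no such bound, and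
    [tr_free] is the resulting geometric series, multiplied by 1 - q^(L-1). *)
Record transfer (R : comNzRingType) (q : q_system R) (p : nat) (tau : rat)
    (w : int -> int -> rat) (v : int -> int -> int) (f : int -> R)
    (F : nat -> int -> int -> int -> R) : Prop := Transfer {
  tr0 : forall a b k, F 0 a b k = 0;
  tr1 : forall a b k, F 1 a b k = f b;
  tr_neg : forall L a b k, k <= 0 -> F L a b k = F L a b 0;
  tr_turn : forall L a b k, edge p a b -> 0 <= k ->
    F L a b k = F L a b (k + 1) + step_power q (w a b + k%:~R) L * F L.-1 b a (v a b - k);
  tr_free : forall L a b k, edge p a b -> 0 <= k -> v a b <= k ->
    (1 - step_power q 1 L) * F L a b k =
      (if is_end p b then 0 else step_power q tau L * F L.-1 b (2 * b - a) 0)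
      + step_power q (w a b + k%:~R) L * F L.-1 b a 0 }.

Section Insertion.
Variables (R : comNzRingType) (q : q_system R) (p : nat) (tau : rat).
Variables (w : int -> int -> rat) (v v' : int -> int -> int) (f : int -> R).
Variables (F G : nat -> int -> int -> int -> R).
Local Notation c := (turn_drop p).
Hypothesis vw : forall a b, edge p a b -> w a b + w b a = 1 - (v a b)%:~R.
Hypothesis v'E : forall a b, v' a b = v a b + 1 - c a - c b.
Hypothesis v'_ge : forall a b, edge p a b -> -1 <= v' a b.
Hypothesis vC : forall a b, edge p a b -> v a b = v b a.
Hypothesis w_inner : forall a b, edge p a b -> ~~ is_end p b ->
  w b a + w b (2 * b - a) = 3 - 2 * tau.
Hypothesis trF : transfer q p tau w v f F.
Hypothesis trG : transfer q p tau (fun a b => w a b + (c a)%:~R) v' f G.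

Local Notation Y := (step_power q).
Local Notation U := (insertion q).

Let e a b : bool := v' a b == -1.

(** If v' = -1, two consecutive riggings c - 1 are compatible, so that runs of
    them occur; consecutive ones pair up.  The transform of G only reaches the
    paths whose initial run has even length, which the alternating recursion
    extracts. *)
Fixpoint even_run (L : nat) (a b : int) : R :=
  if L is L'.+1 then
    F L a b (c a - 1) - Y (w a b + (c a)%:~R - 1) L * even_run L' b a
  else 0.

(** The members u = 0 and u = v' of the family F(a, b; c(a) + u); for v' = -1 both
    are replaced by [even_run]. *)
Let Bot L a b := if e a b then even_run L a b else F L a b (c a).
Let Top L a b := if e a b then even_run L a b else F L a b (c a + v' a b).

Lemma v'C a b : edge p a b -> v' a b = v' b a.
Proof. by move=> ab; rewrite !v'E (vC ab); ring. Qed.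

Lemma c_ge1 a : 1 <= c a. Proof. by rewrite /turn_drop; case: ifP. Qed.

Lemma c_inner b : ~~ is_end p b -> c b = 1.
Proof. by rewrite /turn_drop => /negPf->. Qed.

Lemma c_end b : is_end p b -> c b = 2.
Proof. by rewrite /turn_drop => ->. Qed.

Lemma exponent_sum a b : edge p a b ->
  w a b + (c a)%:~R + (v' a b)%:~R = 2 - (w b a + (c b)%:~R).
Proof.
by move=> ab; have := vw ab; rewrite v'E; lra.
Qed.

Lemma eC a b : edge p a b -> e b a = e a b.
Proof. by move=> ab; rewrite /e v'C // edgeC. Qed.

(** Turns with rigging c - 1 belong to pairs; splitting them off leaves the members
    of the family for which the induction hypothesis is available. *)
Lemma split_tight_turns L a b : edge p a b ->
  F L.+1 a b (c a - 1) =
    Bot L.+1 a b + Y (w a b + (c a)%:~R - 1) L.+1 * Top L b a.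
Proof.
move=> ab; rewrite /Bot /Top (eC ab); case: ifP => eab; first by rewrite /= subrK.
rewrite (tr_turn trF) //; last by have := c_ge1 a; lia.
rewrite subrK (_ : w a b + (c a - 1)%:~R = w a b + (c a)%:~R - 1); last by ring.
by rewrite (_ : v a b - (c a - 1) = c b + v' b a) // -(v'C ab) v'E; ring.
Qed.

(** With [split_tight_turns] at both edges leaving b, the recursion at u = v' involves
    members of the family only. *)
Lemma Top_inner N a b : edge p a b -> ~~ is_end p b ->
  let g := w b a + (c b)%:~R in let h := w b (2 * b - a) + (c b)%:~R in
  (1 - Y 1 N.+2) * Top N.+2 a b =
    Y tau N.+2 * (Bot N.+1 b (2 * b - a) + Y (h - 1) N.+1 * Top N (2 * b - a) b)
    + Y (2 - g) N.+2 *
      (Y (e a b)%:R N.+2 * Bot N.+1 b a + Y (g - 1) N.+1 * Top N a b).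
Proof.
move=> ab bI g h; have bd := edge_next ab bI; have ba : edge p b a by rewrite edgeC.
have cb := c_inner bI; rewrite /h /g.
rewrite -(split_tight_turns _ bd) cb subrr.
have FA : F N.+1 b a 0 = Bot N.+1 b a + Y (g - 1) N.+1 * Top N a b.
  by rewrite -(split_tight_turns _ ba) cb.
have xE := exponent_sum ab.
have [eab|eab] := boolP (e a b); last first.
  rewrite {1}/Top (negPf eab) (tr_free trF) //; first last.
  - by have := v'E a b; rewrite cb; lia.
  - by move: eab; rewrite /e; have := v'_ge ab; have := c_ge1 a; lia.
  rewrite (negPf bI) (_ : w a b + _ = 2 - (w b a + 1%:~R)); last by rewrite cb in xE; lra.
  by rewrite FA /g cb step_power0 mul1r.
rewrite {1}/Top eab [even_run _ _ _]/= mulrBr (tr_free trF) //; first last.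
- by have := v'E a b; move: eab; rewrite /e cb; lia.
- by have := c_ge1 a; lia.
rewrite (negPf bI) -/(even_run N.+1 b a) FA.
have yE : w a b + (c a)%:~R - 1 = 2 - (w b a + 1%:~R).
  by rewrite cb (eqP eab) in xE; lra.
rewrite yE (_ : w a b + (c a - 1)%:~R = 2 - (w b a + 1%:~R)); last by lra.
rewrite (_ : even_run N.+1 b a = Bot N.+1 b a) /=; last by rewrite /Bot (eC ab) eab.
by rewrite /g cb; ring.
Qed.

(** Since c(b) = 2, the reversed edge admits the riggings 0 and 1 besides those of
    the family, hence the additional term H. *)
Lemma Top_end N a b : edge p a b -> is_end p b ->
  let g := w b a + (c b)%:~R in
  let H n := F n a b (c a + v' a b + 1) in
  [/\ (1 - Y 1 N.+2) * H N.+2 =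
        Y (3 - g) N.+2 * (Bot N.+1 b a + Y (g - 1) N.+1 * Top N a b
                          + Y (g - 2) N.+1 * H N)
    & Top N.+2 a b = H N.+2
        + (if e a b then 0 else Y (2 - g) N.+2 * Bot N.+1 b a)
        + Y (2 - g) N.+2 * Y (g - 1) N.+1 * Top N a b].
Proof.
move=> ab bE g H; have ba : edge p b a by rewrite edgeC.
have cb := c_end bE; have ca := c_ge1 a; have v1 := v'_ge ab.
have vE : v a b = c a + v' a b + 1 by rewrite v'E cb; ring.
have xE := exponent_sum ab.
have F1 : F N.+1 b a 1 = Bot N.+1 b a + Y (g - 1) N.+1 * Top N a b.
  by rewrite -(split_tight_turns _ ba) cb.
have F0 : F N.+1 b a 0 = Bot N.+1 b a + Y (g - 1) N.+1 * Top N a b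
                          + Y (g - 2) N.+1 * H N.
  rewrite (tr_turn trF) // add0r F1 -(vC ab) vE [_ + 1 - 0]subr0 -/(H N).
  by rewrite (_ : g - 2 = w b a + 0%:~R) // /g cb; lra.
split.
  rewrite /H (tr_free trF) ?vE //; last by lia.
  rewrite bE add0r -/(H N.+2) F0.
  by rewrite (_ : w a b + _ = 3 - g) // /g; lra.
have [eab|eab] := boolP (e a b).
  rewrite addr0 {1}/Top eab [even_run _ _ _]/= (tr_turn trF) //; last by lia.
  rewrite subrK {1}/H (_ : c a + v' a b + 1 = c a); last by rewrite (eqP eab); ring.
  rewrite (_ : v a b - _ = 1); last by rewrite vE (eqP eab); ring.
  rewrite -/(even_run N.+1 b a) F1.
  rewrite (_ : even_run N.+1 b a = Bot N.+1 b a); last by rewrite /Bot (eC ab) eab.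
  rewrite (_ : w a b + (c a - 1)%:~R = 2 - g); last first.
    by rewrite (eqP eab) in xE; rewrite /g; lra.
  rewrite (_ : w a b + (c a)%:~R - 1 = 2 - g); last first.
    by rewrite (eqP eab) in xE; rewrite /g; lra.
  by ring.
rewrite {1}/Top (negPf eab) (tr_turn trF) //; last first.
  by move: eab; rewrite /e; lia.
rewrite -/(H N.+2) (_ : v a b - _ = 1); last by rewrite vE; ring.
rewrite F1 (_ : w a b + _ = 2 - g); last by rewrite /g; lra.
by ring.
Qed.

Definition inserted L : Prop := forall a b, edge p a b ->
  [/\ ~~ e a b -> forall u, 0 <= u <= v' a b ->
        F L a b (c a + u) = U (w a b + (c a + u)%:~R - 2) (fun n => G n a b u) L,
      e a b -> even_run L a b = U (w a b + (c a)%:~R - 3) (fun n => G n a b 0) L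
    & is_end p b -> F L a b (c a + v' a b + 1) =
        U (1 - (w b a + (c b)%:~R)) (fun n => G n a b (v' a b + 1)) L].

Lemma inserted_Bot L a b : inserted L -> edge p a b ->
  Bot L a b = U (w a b + (c a)%:~R - 2 - (e a b)%:R) (fun n => G n a b 0) L.
Proof.
move=> IH ab; have [IH1 IH2 _] := IH a b ab; rewrite /Bot.
case: ifPn => [eab|eab].
  by rewrite IH2 // (_ : _ - 3 = w a b + (c a)%:~R - 2 - true%:R) //=; ring.
rewrite -[c a in LHS]addr0 IH1 ?addr0 ?subr0 //.
by move: eab; rewrite /e; have := v'_ge ab; lia.
Qed.

Lemma inserted_Top L a b : inserted L -> edge p a b ->
  Top L a b = U (- (w b a + (c b)%:~R)) (fun n => G n a b (v' a b + (e a b)%:Z)) L.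
Proof.
move=> IH ab; have [IH1 IH2 _] := IH a b ab; rewrite /Top.
have xE := exponent_sum ab.
case: ifPn => [eab|eab].
  rewrite IH2 // (eqP eab) (_ : _ - 3 = - (w b a + (c b)%:~R)) //.
  by rewrite (eqP eab) in xE; lra.
rewrite IH1 //; last by move: eab; rewrite /e; have := v'_ge ab; lia.
by rewrite addr0 (_ : _ - 2 = - (w b a + (c b)%:~R)) //; lra.
Qed.

Lemma inserted0 : inserted 0.
Proof.
have U0 k H : H 0%N = 0 -> U k H 0 = 0.
  by move=> H0; rewrite /insertion big_ord_recl big_ord0 H0 mulr0 addr0.
move=> a b ab; split=> *; rewrite U0 ?(tr0 trG) ?(tr0 trF) //.
Qed.

Lemma inserted1 : inserted 1.
Proof.
move=> a b ab; split=> *; rewrite insertion_at1 ?(tr0 trG) ?(tr1 trG) ?(tr1 trF) //=.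
by rewrite (tr1 trF) mulr0 subr0.
Qed.

Lemma inserted_step_inner N a b : inserted N -> inserted N.+1 -> edge p a b ->
  ~~ is_end p b -> Top N.+2 a b =
    U (- (w b a + (c b)%:~R)) (fun n => G n a b (v' a b + (e a b)%:Z)) N.+2.
Proof.
move=> IH0 IH1 ab bI; have ba : edge p b a by rewrite edgeC.
have bd := edge_next ab bI; have db : edge p (2 * b - a) b by rewrite edgeC.
have cb := c_inner bI.
apply: (@interior_step _ _ _ (w b (2 * b - a) + (c b)%:~R) tau (e a b)
  (e (2 * b - a) b) (fun n => G n b a 0) (fun n => G n b (2 * b - a) 0) _
  (fun n => G n (2 * b - a) b (v' (2 * b - a) b + (e (2 * b - a) b)%:Z))).
- by have := w_inner ab bI; rewrite cb; lra.
- exact: tr0 trG _ _ _.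
- exact: tr0 trG _ _ _.
- exact: tr0 trG _ _ _.
- exact: tr0 trG _ _ _.
- by rewrite !(tr1 trG).
- move=> n; rewrite (tr_free trG) // ?(negPf bI) //; first last.
  + by lia.
  + by rewrite /e; have := v'_ge ab; case: eqP; lia.
  by congr (_ + Y _ _ * _); have := exponent_sum ab; lra.
- move=> n; rewrite (tr_free trG) // ?(negPf bI) //; first last.
  + by lia.
  + by rewrite /e; have := v'_ge db; case: eqP; lia.
  rewrite (_ : 2 * b - (2 * b - a) = a); last by ring.
  by congr (_ + Y _ _ * _); have := exponent_sum db; lra.
- rewrite (Top_inner _ ab bI) (inserted_Bot IH1 bd) (inserted_Bot IH1 ba).
  rewrite (inserted_Top IH0 db) (inserted_Top IH0 ab).
  rewrite (eC ab) -(eC bd).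
  by congr (_ * (U _ _ _ + _) + _ * (_ * U _ _ _ + _)); lra.
Qed.

Lemma inserted_step_end N a b : inserted N -> inserted N.+1 -> edge p a b ->
  is_end p b ->
  F N.+2 a b (c a + v' a b + 1) =
    U (1 - (w b a + (c b)%:~R)) (fun n => G n a b (v' a b + 1)) N.+2
  /\ Top N.+2 a b =
    U (- (w b a + (c b)%:~R)) (fun n => G n a b (v' a b + (e a b)%:Z)) N.+2.
Proof.
move=> IH0 IH1 ab bE; have ba : edge p b a by rewrite edgeC.
have [HE TE] := Top_end N ab bE; have cb := c_end bE; have xE := exponent_sum ab.
have [_ _ HN] := IH0 a b ab.
have v'1 : 0 <= v' a b + (e a b)%:Z.
  by rewrite /e; have := v'_ge ab; case: eqP; lia.
have GT n : (1 - Y 1 n) * G n a b (v' a b + (e a b)%:Z)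
    = Y (2 - (w b a + (c b)%:~R) + (e a b)%:R) n * G n.-1 b a 0.
  rewrite (tr_free trG) ?bE ?add0r //; last by lia.
  by congr (Y _ _ * _); lra.
apply: (@end_step _ _ _ (e a b) (fun n => G n b a 0)) => //.
- exact: tr0 trG _ _ _.
- exact: tr0 trG _ _ _.
- move=> n; case: (e a b) GT v'1 => //=; rewrite addr0 => GT v'1.
  have := GT n; rewrite mulrBl mul1r {1}(tr_turn trG n ab v'1) subrr.
  rewrite (_ : w a b + (c a)%:~R + (v' a b)%:~R = 2 - (w b a + (c b)%:~R) + 0) //; last by lra.
  move=> /eqP; rewrite -subr_eq0 => /eqP diff0.
  by apply/eqP; rewrite -subr_eq0 -diff0; apply/eqP; ring.
- rewrite HE (inserted_Bot IH1 ba) (inserted_Top IH0 ab) (HN bE) (eC ab).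
  by congr (Y _ _ * (U _ _ _ + _ + _)); lra.
- rewrite TE (inserted_Bot IH1 ba) (inserted_Top IH0 ab) (eC ab).
  by case: (e a b); rewrite /= ?subr0.
Qed.

(** The step from u + 1 to u is [middle_step]; it starts at u = v'. *)
Lemma inserted_step N : inserted N -> inserted N.+1 -> inserted N.+2.
Proof.
move=> IH0 IH1 a b ab; have ba : edge p b a by rewrite edgeC.
have topE : Top N.+2 a b =
    U (- (w b a + (c b)%:~R)) (fun n => G n a b (v' a b + (e a b)%:Z)) N.+2.
  have [bE|bI] := boolP (is_end p b); first by have [] := inserted_step_end IH0 IH1 ab bE.
  exact: inserted_step_inner.
have xE := exponent_sum ab.
split=> [eab|eab|bE]; last by have [] := inserted_step_end IH0 IH1 ab bE.
  (* Descending induction on u = v' - j. *)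
  have main (j : nat) : j%:Z <= v' a b ->
      F N.+2 a b (c a + (v' a b - j%:Z)) =
      U (w a b + (c a + (v' a b - j%:Z))%:~R - 2) (fun n => G n a b (v' a b - j%:Z)) N.+2.
    elim: j => [_|j IHj lejv].
      rewrite subr0; move: topE; rewrite /Top (negPf eab) [_ + false%:Z]addr0 => ->.
      by congr (U _ _ _); lra.
    have {}IHj := IHj (ltac:(lia)); set u := v' a b - j.+1%:Z.
    have uE : v' a b - j%:Z = u + 1 by rewrite /u; lia.
    rewrite {}uE in IHj; have c1 := c_ge1 a.
    rewrite (tr_turn trF) //; last by rewrite /u; lia.
    rewrite -addrA IHj (_ : v a b - (c a + u) = c b + (v' b a - 1 - u)); last first.
      by rewrite -(v'C ab) v'E; ring.
    have [IH _ _] := IH1 b a ba.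
    rewrite /= IH ?(eC ab) //; last by rewrite -(v'C ab) /u; lia.
    rewrite -(@middle_step _ _ (w a b + (c a + u)%:~R)
      (w b a + (c b + (v' b a - 1 - u))%:~R) _ (fun n => G n a b (u + 1))
      (fun n => G n b a (v' a b - u)) (fun n => G n b a (v' b a - 1 - u))).
    - by congr (U _ _ _ + _); lra.
    - by rewrite -(v'C ab); lra.
    - exact: tr0 trG _ _ _.
    - exact: tr0 trG _ _ _.
    - move=> n; rewrite (tr_turn trG n ab); last by rewrite /u; lia.
      by congr (_ + Y _ _ * _); lra.
    - move=> n; rewrite (tr_turn trG n ba); last by rewrite -(v'C ab) /u; lia.
      rewrite -(v'C ab) (_ : v' a b - 1 - u + 1 = v' a b - u); last by ring.
      rewrite (_ : v' a b - (v' a b - 1 - u) = u + 1); last by ring.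
      by congr (_ + Y _ _ * _); lra.
  move=> u /andP[u0 uv]; have := main `|v' a b - u|%N.
  have -> : `|v' a b - u|%:Z = v' a b - u by lia.
  by rewrite subKr; apply; lia.
move: topE; rewrite /Top eab (eqP eab) /= addrC subrr => ->.
by congr (U _ _ _); rewrite (eqP eab) in xE; lra.
Qed.
(** Here v = c(a) + v' + 1, so that the next turn is not bounded by the first. *)
Lemma transfer_insertion L a b : edge p a b -> is_end p b ->
  F L a b (v a b) =
    U (1 - (w b a + (c b)%:~R)) (fun n => G n a b (v' a b + 1)) L.
Proof.
move=> ab bE; have [] : inserted L /\ inserted L.+1.
  elim: L => [|L [IH0 IH1]]; first by split; [apply: inserted0|apply: inserted1].
  by split=> //; apply: inserted_step.
move=> /(_ a b ab)[_ _ /(_ bE) <- _].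
by congr (F _ _ _ _); rewrite v'E (c_end bE); ring.
Qed.

End Insertion.

(** * Generating series of sets *)

Section GeneratingSeries.
Implicit Types (T : choiceType).

Definition finite_below T (A : set T) (d : T -> rat) : Prop :=
  forall e, finite_set (A `&` [set x | d x <= e]).

Lemma finite_below_sub T (A B : set T) (d : T -> rat) :
  A `<=` B -> finite_below B d -> finite_below A d.
Proof. by move=> AB Bd e; apply: sub_finite_set (Bd e) => x [/AB]. Qed.

(** Every coefficient counts a fiber of the degree. *)
Lemma qsum_fiber T (A : set T) (d : T -> rat) e :
  qsum A (fun x => qpow (d x)) e = \sum_(x \in A `&` [set x | d x = e]) (1 : int).
Proof.
transitivity (\sum_(x \in A `&` [set x | d x = e]) qpow (d x) e).
  rewrite /qsum; symmetry; apply: fsbig_widen => [x []//|x [Ax /= nfx]].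
  rewrite /qpow; case: eqVneq => // dx; case: nfx; split => //.
by apply: eq_fsbigr => x; rewrite inE /qpow => -[_ /= ->]; rewrite eqxx.
Qed.

Lemma finite_fiber T (A : set T) (d : T -> rat) e : finite_below A d ->
  finite_set (A `&` [set x | d x = e]).
Proof. by move=> /(_ e); apply: sub_finite_set => x [Ax /= ->]. Qed.

Lemma gf_left_finite T (A : set T) (d : T -> rat) : finite_below A d ->
  left_finite (qsum A (fun x => qpow (d x))).
Proof.
move=> Ad e; have /finite_seqP[s sE] := finite_image d (Ad e); exists s => x xe.
apply: contraR => /negP xs; rewrite qsum_fiber fsbig1 // => y [Ay /= dy].
have : [set` s] x by rewrite -sE; exists y => //; split; rewrite //= dy.
by move/xs.
Qed.

(** Zero when [A] has infinitely many elements of bounded degree, so that no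
    finiteness proof is carried around. *)
Definition gf T (A : set T) (d : T -> rat) : lfseries :=
  if pselect (finite_below A d) is left Ad then LFSeries (gf_left_finite Ad) else 0.

Lemma gfE T (A : set T) (d : T -> rat) : finite_below A d ->
  coef (gf A d) = qsum A (fun x => qpow (d x)).
Proof. by rewrite /gf; case: pselect. Qed.

Lemma gfU T (A B : set T) (d : T -> rat) : finite_below (A `|` B) d ->
  A `&` B `<=` set0 -> gf (A `|` B) d = gf A d + gf B d.
Proof.
move=> ABd dis; have Ad : finite_below A d by apply: finite_below_sub ABd => x; left.
have Bd : finite_below B d by apply: finite_below_sub ABd => x; right.
apply: lfseriesP => e; rewrite lfcoefD !gfE // !qsum_fiber setIUl fsbigU0 //.
- exact: finite_fiber.
- exact: finite_fiber.
- by move=> x [[Ax _] [Bx _]]; apply: (dis x).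
Qed.

Lemma gf_set0 T (d : T -> rat) : gf set0 d = 0.
Proof.
apply: lfseriesP => e; rewrite gfE; last by move=> ?; rewrite set0I; exact: finite_set0.
by rewrite /qsum fsbig_set0.
Qed.

Lemma gf_set1 T (x : T) (d : T -> rat) : gf [set x] d = q_ (d x).
Proof.
apply: lfseriesP => e; rewrite gfE; last first.
  by move=> ?; apply: sub_finite_set (finite_set1 x) => y [].
by rewrite /qsum fsbig_set1.
Qed.

Lemma finite_below_bij T T' (A : set T) (B : set T') (h : T -> T') d d' a :
  set_bij A B h -> (forall x, A x -> d' (h x) = d x + a) ->
  finite_below A d -> finite_below B d'.
Proof.
move=> [_ _ surj] dh Ad e; apply: sub_finite_set (finite_image h (Ad (e - a))).
move=> y [/surj[x Ax <-] /=]; rewrite dh // => le; exists x => //; split => //=.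
by lra.
Qed.

Lemma gf_bij T T' (A : set T) (B : set T') (h : T -> T') d d' a :
  set_bij A B h -> (forall x, A x -> d' (h x) = d x + a) ->
  finite_below A d -> gf B d' = q_ a * gf A d.
Proof.
move=> hAB dh Ad; have Bd := finite_below_bij hAB dh Ad.
apply: lfseriesP => e; rewrite lfcoef_qM !gfE // /qsum (reindex_fsbig h A) //.
apply: eq_fsbigr => x; rewrite inE => Ax; rewrite /qpow dh //.
by congr (nat_of_bool _)%:R; apply/eqP/eqP; lra.
Qed.

Lemma gf_image T T' (A : set T) (h : T -> T') d d' a :
  set_inj A h -> (forall x, A x -> d' (h x) = d x + a) ->
  finite_below A d -> gf (h @` A) d' = q_ a * gf A d.
Proof. by move=> /inj_bij; apply: gf_bij. Qed.

End GeneratingSeries.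

(** * Tails of rigged paths *)

(** All words of length n over X, for finiteness arguments. *)
Fixpoint words (X : seq int) (n : nat) : seq (seq int) :=
  if n is n'.+1 then [seq x :: s | x <- X, s <- words X n'] else [:: [::]].

Lemma words_mem (X : seq int) (s : seq int) :
  {subset s <= X} -> s \in words X (size s).
Proof.
elim: s => //= x s IHs sX; apply/allpairsP; exists (x, s); split=> //=.
  by apply: sX; rewrite mem_head.
by apply: IHs => y ys; apply: sX; rewrite inE ys orbT.
Qed.

Definition lf_system : q_system lfseries :=
  QSystem q0 qD (fun n f g => @mul1Bq_inj n.+1%:R f g (ltr0Sn _ n)) qpochV0 qpochVS.

Section Tails.
Variables (p : nat) (t : rat) (r : int).
Hypothesis t0 : 0 <= t.

Definition turn_weight (a b : int) : rat := weight p t a b a.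

Definition turn_bound (a b : int) : int := Num.floor (vbound p t (Num.min a b)).
Local Notation v := turn_bound.

(** The steps and riggings that can follow a step a -> b.  The argument k is the
    least rigging allowed for an immediate turn back to a, as left over by the
    preceding turn. *)
Fixpoint tail (a b k : int) (rs ss : seq int) : bool :=
  match rs, ss with
  | [::], [::] => b == r
  | c :: rs', s :: ss' =>
      [&& 0 <= s, edge p b c &
          if c == a then (k <= s) && tail b c (v a b - s) rs' ss'
          else tail b c 0 rs' ss']
  | _, _ => false
  end.

Fixpoint tail_degree (a b : int) (rs ss : seq int) : rat :=
  match rs, ss with
  | c :: rs', s :: ss' =>
      (size rs)%:R * (weight p t c b a + s%:~R) + tail_degree b c rs' ss'
  | _, _ => 0
  end.

Definition tails (n : nat) (a b k : int) : set rpath :=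
  [set P | size P.1 = n /\ tail a b k P.1 P.2].

Definition tdeg (a b : int) (P : rpath) : rat := tail_degree a b P.1 P.2.

Definition tail_gf (L : nat) (a b k : int) : lfseries :=
  if L is n.+1 then gf (tails n a b k) (tdeg a b) else 0.

Lemma weight_ge a b c : 0 <= weight p t c b a + 3 * t.
Proof.
have /andP[le_fl lt_fl] := floor_itv (c%:~R * t).
have t_ge0 := t0; rewrite /weight; repeat case: ifP => _; lra.
Qed.

Lemma tail_shape a b k rs ss : tail a b k rs ss ->
  [/\ size ss = size rs, all (node p) rs & all (fun s => 0 <= s) ss].
Proof.
elim: rs a b k ss => [|c rs IHrs] a b k [|s ss] //= /and3P[s0 bc H].
have [k' H'] : exists k', tail b c k' rs ss.
  by case: ifP H => _ => [/andP[_ H]|H]; eexists; exact: H.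
have [-> -> ->] := IHrs _ _ _ _ H'.
by split=> //; rewrite ?s0 //; move: bc; rewrite /edge => /and3P[_ ->].
Qed.

(** Every rigging counts at least once, and each of the n weights is at least -3t,
    with multiplicity at most n. *)
Lemma tail_degree_ge a b rs ss : size ss = size rs -> all (fun s => 0 <= s) ss ->
  (\sum_(s <- ss) s)%:~R - 3 * t * (size rs)%:R ^+ 2 <= tail_degree a b rs ss.
Proof.
elim: rs a b ss => [|c rs IHrs] a b [|s ss] //=; first by rewrite big_nil expr0n mulr0 subrr.
move=> [sz] /andP[s0 ss0]; have := IHrs b c ss sz ss0; rewrite big_cons.
have := weight_ge a b c; set W := weight _ _ _ _ _; set D := tail_degree _ _ _ _.
set S := \sum_(_ <- _) _; rewrite -[(size rs).+1%:R]natr1.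
have n0 : 0 <= (size rs)%:R :> rat by [].
have s0' : 0 <= s%:~R :> rat by rewrite ler0z.
move: (size rs)%:R n0 => n n0 W0 D0.
have := mulr_ge0 n0 s0'; have := mulr_ge0 n0 t0.
have : 0 <= (n + 1) * (W + 3 * t) by apply: mulr_ge0; lra.
by rewrite intrD; nra.
Qed.

(** A bound on the degree bounds each rigging by [tail_degree_ge]. *)
Lemma tails_finite n a b k : finite_below (tails n a b k) (tdeg a b).
Proof.
move=> e; set M := Num.truncn (e + 3 * t * n%:R ^+ 2).
pose X : seq int := [seq i%:Z | i <- iota 0 M.+1].
apply: (@sub_finite_set _ _ [set` [seq (rs, ss) |
  rs <- words [seq i%:Z | i <- iota 0 p] n, ss <- words X n]]).
  move=> [rs ss] [[/= szn Ht]]; rewrite /tdeg /= => le_e.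
  have [szs nrs ss0] := tail_shape Ht; rewrite -szn; subst n.
  apply/allpairsP; exists (rs, ss); split=> //=.
    apply: words_mem => x /(allP nrs); rewrite /node => xP.
    by apply/mapP; exists `|x|%N; rewrite ?mem_iota; lia.
  rewrite -szs; apply: words_mem => x xs; have := allP ss0 x xs => x0.
  apply/mapP; exists `|x|%N; last by lia.
  rewrite mem_iota add0n /= -(ltr_nat rat); apply: le_lt_trans (truncnS_gt _).
  have xsum : x <= \sum_(s <- ss) s.
    by rewrite (big_rem x) //= lerDl big_seq sumr_ge0 // => y /mem_rem/(allP ss0).
  have := tail_degree_ge a b szs ss0.
  have : x%:~R <= (\sum_(s <- ss) s)%:~R :> rat by rewrite ler_int.
  have -> : (`|x|%N)%:R = x%:~R :> rat by rewrite -[x in RHS]gez0_abs.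
  by lra.
exact: finite_seq.
Qed.

Definition pcons (c s : int) (P : rpath) : rpath := (c :: P.1, s :: P.2).

Definition pincr (x : int) (P : rpath) : rpath :=
  (P.1, if P.2 is s :: ss then s + x :: ss else [::]).

Lemma pcons_inj c s (A : set rpath) : set_inj A (pcons c s).
Proof. by move=> [u1 u2] [v1 v2] _ _ [-> ->]. Qed.

Lemma pincr_inj x (A : set rpath) : set_inj A (pincr x).
Proof.
move=> [u1 [|s ss]] [v1 [|s' ss']] _ _ [] //; first by move=> ->.
by move=> -> /addIr -> ->.
Qed.

Lemma tdeg_cons n a b c s P : size P.1 = n ->
  tdeg a b (pcons c s P) = tdeg b c P + (weight p t c b a + s%:~R) * n.+1%:R.
Proof. by rewrite /tdeg /= => ->; rewrite addrC mulrC. Qed.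

Lemma tail_neg a b k rs ss : k <= 0 -> tail a b k rs ss = tail a b 0 rs ss.
Proof.
case: rs ss => [|c rs] [|s ss] //= k0; case s0: (0 <= s) => //=.
by case: ifP; rewrite ?s0 ?(le_trans k0 s0).
Qed.

Lemma tails0 a b k : tails 0 a b k = if b == r then [set ([::], [::])] else set0.
Proof.
apply/seteqP; split=> [[[|? ?] [|? ?]] [] //= _ -> //|[rs ss]].
by case: ifP => //= br [-> ->].
Qed.

Lemma tail_gf1 a b k : tail_gf 1 a b k = (b == r)%:R.
Proof. by rewrite /= tails0; case: ifP => _; rewrite ?gf_set1 ?gf_set0. Qed.

Lemma tails_turn n a b k : edge p a b -> 0 <= k ->
  tails n.+1 a b k =
    tails n.+1 a b (k + 1) `|` pcons a k @` tails n b a (v a b - k).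
Proof.
move=> ab k0; apply/seteqP; split.
  move=> [[|c rs] [|s ss]] [] //= [sz] /and3P[s0 bc].
  case: eqVneq bc => [->|ca] bc H; last by left; split; rewrite /= ?sz // s0 bc (negPf ca).
  case/andP: H; rewrite le_eqVlt => /predU1P[<-|ks] H.
    by right; exists (rs, ss).
  by left; split; rewrite /= ?sz // s0 bc eqxx H -ltzD1 ltrD2r ks.
move=> P [|[[rs ss] [/= sz H] <-]]; last first.
  by split; rewrite /= ?sz // k0 edgeC ab eqxx lexx.
case: P => [[|c rs] [|s ss]] [] //= sz /and3P[s0 bc H]; split; rewrite /= ?sz // s0 bc.
by case: ifP H => // _ /andP[ks ->]; rewrite andbT; lia.
Qed.

(** For k >= v the riggings of the first step can be raised freely: the tails that
    are not obtained by raising are the straight ones with rigging 0 and the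
    turns with rigging k. *)
Lemma tails_free n a b k : edge p a b -> 0 <= k -> v a b <= k ->
  tails n.+1 a b k =
    pincr 1 @` tails n.+1 a b k `|`
    ((if is_end p b then set0 else pcons (2 * b - a) 0 @` tails n b (2 * b - a) 0)
     `|` pcons a k @` tails n b a 0).
Proof.
move=> ab k0 vk.
have tailv c rs ss s : k <= s -> tail b c (v a b - s) rs ss = tail b c 0 rs ss.
  by move=> ks; rewrite tail_neg //; lia.
apply/seteqP; split.
  move=> [[|c rs] [|s ss]] [] //= [sz] /and3P[s0 bc].
  case: eqVneq bc => [->|ca] bc.
    case/andP => ks; rewrite tailv // => H.
    move: ks; rewrite le_eqVlt => /predU1P[<-|ks]; first by right; right; exists (rs, ss).
    left; exists (a :: rs, s - 1 :: ss); last by rewrite /pincr /= subrK.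
    split; rewrite /= ?sz // bc eqxx tailv; last by lia.
    by rewrite H !andbT; lia.
  move=> H; have cE : c = 2 * b - a by move: ab bc; rewrite /edge; lia.
  move: s0; rewrite le_eqVlt => /predU1P[<-|s0].
    right; left; rewrite ifF -?cE; first by exists (rs, ss).
    by move: bc ca; rewrite cE /edge /node /is_end; move: ab; rewrite /edge /node; lia.
  left; exists (c :: rs, s - 1 :: ss); last by rewrite /pincr /= subrK.
  by split; rewrite /= ?sz // bc (negPf ca) H andbT; lia.
move=> P [[[[|c rs] [|s ss]] [] //= sz /and3P[s0 bc H] <-]|[|]].
- split; rewrite //= bc; apply/and3P; split=> //; first by lia.
  case: ifP H => // _ /andP[ks]; rewrite !tailv //; last by lia.
  by move=> ->; rewrite andbT; lia.
- case: ifPn => // bI [[rs ss] [/= sz H] <-].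
  split; rewrite /= ?sz // (edge_next ab bI) ifF //.
  by move: ab; rewrite /edge; lia.
- move=> [[rs ss] [/= sz H] <-].
  by split; rewrite /= ?sz // k0 edgeC ab eqxx lexx tailv.
Qed.

Lemma step_power_lf x n : step_power lf_system x n.+2 = q_ (x * n.+1%:R).
Proof. by rewrite /step_power -[n.+2%:R]natr1 addrK. Qed.

Lemma tail_transfer :
  transfer lf_system p (t / 2) turn_weight v (fun b => (b == r)%:R) tail_gf.
Proof.
split=> //.
- exact: tail_gf1.
- case=> [|n] a b k k0 //=; congr (gf _ _); apply/seteqP.
  by split=> -[rs ss] [/= sz H]; split=> //=; move: H; rewrite (tail_neg _ _ _ _ k0).
- case=> [|[|n]] a b k ab k0; first by rewrite mulr0 addr0.
    by rewrite mulr0 addr0 !tail_gf1.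
  rewrite [n.+2.-1]/= ![tail_gf _ _ _ _]/=.
  rewrite (tails_turn n ab k0) gfU; first last.
  + move=> [[|c rs] [|s ss]] [[] //= _ /and3P[_ _ H] [P _ [ca ks]]].
    by move: H; rewrite -ca -ks eqxx => /andP[+ _]; lia.
  + by rewrite -tails_turn //; apply: tails_finite.
  congr (_ + _); rewrite (@gf_image _ _ _ _ (tdeg b a) _ ((turn_weight a b + k%:~R) * n.+1%:R)).
  + by rewrite step_power_lf.
  + exact: pcons_inj.
  + by move=> P [sz _]; rewrite (tdeg_cons _ _ _ _ sz).
  + exact: tails_finite.
- case=> [|[|n]] a b k ab k0 vk; first by rewrite !mulr0 if_same addr0.
    by rewrite step_power_at1 subrr mul0r !mulr0 if_same addr0.
  rewrite [n.+2.-1]/= ![tail_gf _ _ _ _]/=.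
  rewrite mulrBl mul1r {1}(tails_free n ab k0 vk).
  have tailsF : finite_below (tails n.+1 a b k) (tdeg a b) by apply: tails_finite.
  rewrite gfU -?tails_free //; last first.
    move=> P [[[[|c rs] [|s ss]] [] //= _ /and3P[s0 _ H] <-]] [|[Q _ [ca ks]]].
      by case: ifP => // _ [Q _ [_ s1]]; move: s0; rewrite /= in s1 *; lia.
    by move: H; rewrite -ca eqxx => /andP[+ _]; move: ks; rewrite /=; lia.
  rewrite gfU; first last.
  + move=> P [+ [Q _ PE]]; rewrite -{P}PE; case: ifP => _; first by case.
    by case=> Q' _ [da *]; move: ab; rewrite /edge; lia.
  + apply: finite_below_sub tailsF; rewrite [X in _ `<=` X](tails_free n ab k0 vk).
    by move=> P; right.
  rewrite (@gf_image _ _ _ _ (tdeg a b) _ (1 * (n.+2%:R - 1))) //; first last.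
  + move=> [[|c rs] [|s ss]] [] //= [sz] _.
    by rewrite /tdeg /= sz -[n.+2%:R]natr1; lra.
  + exact: pincr_inj.
  rewrite -/(step_power lf_system 1 n.+2) addrAC subrr add0r; congr (_ + _).
    case: ifPn => bI; first by rewrite gf_set0.
    rewrite (@gf_image _ _ _ _ (tdeg b (2 * b - a)) _ (t / 2 * n.+1%:R)).
    + by rewrite step_power_lf.
    + exact: pcons_inj.
    + move=> P [sz _]; rewrite (tdeg_cons _ _ _ _ sz) addr0 /weight ifT //.
      by move: ab; rewrite /edge; lia.
    + exact: tails_finite.
  rewrite (@gf_image _ _ _ _ (tdeg b a) _ ((turn_weight a b + k%:~R) * n.+1%:R)).
  + by rewrite step_power_lf.
  + exact: pcons_inj.
  + by move=> P [sz _]; rewrite (tdeg_cons _ _ _ _ sz).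
  + exact: tails_finite.
Qed.

(** * Rigged paths as tails *)

(** The recursion compares each turn with the next one.  In terms of indices, in
    the sequence a, b, rs this is the condition on four consecutive nodes that
    zigzag between two values. *)
Lemma tailP a b k rs ss : tail a b k rs ss <->
  [/\ size ss = size rs, last b rs = r,
      forall i, (i < size rs)%N -> edge p (b :: rs)`_i rs`_i /\ 0 <= ss`_i,
      (0 < size rs)%N -> rs`_0 = a -> k <= ss`_0
    & forall i, (i.+1 < size rs)%N -> rs`_i = (a :: b :: rs)`_i ->
        rs`_i.+1 = (b :: rs)`_i ->
        v (a :: b :: rs)`_i (b :: rs)`_i <= ss`_i + ss`_i.+1].
Proof.
elim: rs a b k ss => [|c rs IHrs] a b k [|s ss]; try by split=> // -[].
  by split=> [/eqP ->|[_ /= ->]] //=.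
have -> : tail a b k (c :: rs) (s :: ss) =
    [&& 0 <= s, edge p b c, (c == a) ==> (k <= s)
      & tail b c (if c == a then v a b - s else 0) rs ss].
  by rewrite /=; case: eqP; rewrite ?andbA.
split.
  move=> /and4P[s0 bc ks /IHrs[sz lst step first zig]]; split=> //=.
  - by rewrite sz.
  - by case=> [|i] //; apply: step.
  - by move=> _ ca; move: ks; rewrite ca eqxx.
  - case=> [|i] /= lti; last by apply: zig.
    move=> ca db; rewrite addrC -lerBlDr.
    by have := first lti db; rewrite ca eqxx.
move=> [/= [sz] lst step first zig]; apply/and4P; split.
- by have [] := step 0.
- by have [] := step 0.
- by apply/implyP => /eqP ca; apply: first.
- apply/IHrs; split=> //.
  + by move=> i lti; apply: (step i.+1).
  + move=> lt0 db; have := zig 0 lt0; case: eqVneq => [ca|_] /=.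
      by move=> /(_ ca db); rewrite lerBlDl.
    by move=> _; have [] := step 1 lt0.
  + by move=> i lti; apply: (zig i.+1).
Qed.

Lemma tail_degreeE a b rs ss : size ss = size rs ->
  tail_degree a b rs ss = \sum_(i < size rs) (size rs - i)%:R *
    (weight p t rs`_i (b :: rs)`_i (a :: b :: rs)`_i + (ss`_i)%:~R).
Proof.
elim: rs a b ss => [|c rs IHrs] a b [|s ss] //=; first by rewrite big_ord0.
by case=> sz; rewrite big_ord_recl /= subn0 IHrs.
Qed.

Hypothesis p3 : (3 <= p)%N.
Hypothesis vbound_int : forall x : int, 1 <= x <= p%:Z - 2 ->
  (Num.floor (vbound p t x))%:~R = vbound p t x.

Lemma pincr_nth x rs ss i : (0 < i)%N -> (pincr x (rs, ss)).2`_i = ss`_i.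
Proof. by case: i ss => // i [|s ss]. Qed.

Lemma pincr_size x rs ss : size (pincr x (rs, ss)).2 = size ss.
Proof. by case: ss. Qed.

Lemma pincr0 x rs ss : (0 < size ss)%N -> (pincr x (rs, ss)).2`_0 = ss`_0 + x.
Proof. by case: ss. Qed.

(** A path from 1 as a tail of the virtual step 2 -> 1: its first step is then a turn,
    and with the rigging raised by k >= v the added turn puts no condition on the
    next one. *)
Lemma tails_Cset n k rs ss : 0 <= k -> v 2 1 <= k ->
  tails n 2 1 k (pincr k (rs, ss)) <-> Cset p t n%:Z r (1 :: rs, ss).
Proof.
move=> k0 vk; rewrite /tails /= -/(pincr k (rs, ss)).2.
set ss' := (pincr k (rs, ss)).2.
split.
  move=> [szr /tailP[]]; rewrite pincr_size szr => szs lst step first zig.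
  have step1 i : (i <= n)%N -> node p (1 :: rs)`_i.
    case: i => [_|i lti]; first by rewrite /node /=; lia.
    by have [/and3P[]] := step i lti.
  split.
  - split=> //=; rewrite ?szr //.
    move=> i lti; have [/and3P[_ _ ab] _] := step i lti.
    by move: ab; rewrite /pr /= !inE; move: rs`_i (1 :: rs)`_i => u u'; lia.
  - split=> [[|i] lti|[|i] // x _ lti xp alt].
    + have [/and3P[n1 n2 e12] _] := step 0 lti.
      have r2 : rs`_0 = 2 by move: n2 e12; rewrite /node /=; move: rs`_0 => u; lia.
      by have := first lti r2; rewrite /psigma /= pincr0 ?szs // lerDr.
    + by have [_] := step _ lti; rewrite pincr_nth.
    + have {}alt j : j \in [:: i; i.+1; i.+2; i.+3] ->
          ((1 :: rs)`_j == x) || ((1 :: rs)`_j == x + 1).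
        by move/alt; rewrite /pr /= !inE.
      have := alt i; have := alt i.+1; have := alt i.+2; have := alt i.+3.
      rewrite !inE !eqxx ?orbT /= => /(_ isT) a3 /(_ isT) a2 /(_ isT) a1 /(_ isT) a0.
      have := zig i.+1 lti; have [/and3P[_ _ s0] _] := step i (ltnW (ltnW lti)).
      have [/and3P[_ _ /= s1] _] := step i.+1 (ltnW lti).
      have [/and3P[_ _ /= s2] _] := step i.+2 lti.
      rewrite !pincr_nth // /psigma /=.
      move: (1 :: rs)`_i rs`_i rs`_i.+1 rs`_i.+2 a0 a1 a2 a3 s0 s1 s2.
      move=> u0 u1 u2 u3 a0 a1 a2 a3 s0 s1 s2 vle.
      rewrite -(vbound_int xp) ler_int.
      have -> : x = Num.min u0 u1 by lia.
      by apply: vle; lia.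
  - by rewrite /pr /= -szr -(last_nth 0).
move=> [[/= [szr] szs p0 nodes steps] [sig adm] lst]; split=> //.
apply/tailP; rewrite pincr_size szr; split=> //.
- by rewrite (last_nth 0) szr.
- move=> i lti; split.
    have := steps i lti; have := nodes i.+1 lti; have := nodes i (ltnW lti).
    rewrite /edge /node /pr /= !inE; move: (1 :: rs)`_i rs`_i => u u'; lia.
  case: i lti => [|i] lti; last by rewrite pincr_nth //; apply: (sig i.+1).
  by rewrite pincr0 ?szs //; apply: addr_ge0 => //; apply: (sig 0).
- by move=> n0 _; rewrite pincr0 ?szs // lerDr; apply: (sig 0).
- case=> [|i] lti /= e1 e2.
    rewrite pincr0 ?szs ?(ltnW lti) // pincr_nth //.
    have := sig 0 (ltnW lti); have := sig 1 lti; rewrite /psigma /=.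
    by move: ss`_0 ss`_1 => x y; lia.
  rewrite !pincr_nth //; have {}adm := adm i.+1 (Num.min (1 :: rs)`_i rs`_i) isT lti.
  move: adm; have := steps i (ltnW (ltnW lti)); rewrite /pr /= !inE.
  have := nodes i (ltnW (ltnW (ltnW lti))); have := nodes i.+1 (ltnW (ltnW lti)).
  rewrite /pr /psigma /= => n1 n0 step {}adm.
  have xp : 1 <= Num.min (1 :: rs)`_i rs`_i <= p%:Z - 2.
    by move: (1 :: rs)`_i rs`_i n0 n1 step => u u'; lia.
  rewrite -(ler_int rat) /turn_bound (vbound_int xp) ; apply: adm => // j.
  move: step e1 e2; rewrite !inE.
  move=> step e1 e2 /or4P[] /eqP -> /=; rewrite ?e2 ?e1;
  by move: (1 :: rs)`_i rs`_i step => u u'; lia.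
Qed.

(** The factor compensates the weight and the rigging of the added turn, which are
    counted n times, against the leading term n * Delta of the degree. *)
Lemma Cset_start n k : 0 <= k -> v 2 1 <= k ->
  ch p t n%:Z r =
  q_ (n%:R * (Delta21 t - turn_weight 2 1 - k%:~R)) * tail_gf n.+1 2 1 k.
Proof.
move=> k0 vk; pose h (P : rpath) : rpath := (1 :: P.1, (pincr (- k) P).2).
have hK rs ss : pincr k (rs, (pincr (- k) (rs, ss)).2) = (rs, ss).
  by case: ss => [|s ss] //; rewrite /pincr /= subrK.
have hV rs ss : (pincr (- k) (pincr k (rs, ss))).2 = ss.
  by case: ss => [|s ss] //; rewrite /pincr /= addrK.
have bij : set_bij (tails n 2 1 k) (Cset p t n%:Z r) h.
  split.
  - by move=> [rs ss] Ht; apply/(tails_Cset _ _ _ k0 vk); rewrite hK.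
  - move=> [rs ss] [rs' ss'] _ _ E; have rsE : rs = rs' by case: E.
    have ssE : (pincr (- k) (rs, ss)).2 = (pincr (- k) (rs', ss')).2 := congr1 snd E.
    by rewrite -(hK rs ss) -(hK rs' ss') ssE rsE.
  - move=> [[|x rs] ss] CP; first by case: CP => [[]].
    have x1 : x = 1 by case: CP => [[]].
    rewrite {}x1 in CP *; exists (pincr k (rs, ss)); first exact/(tails_Cset _ _ _ k0 vk).
    by rewrite /h hV.
have deg P : tails n 2 1 k P -> degree p t (h P) =
    tdeg 2 1 P + n%:R * (Delta21 t - turn_weight 2 1 - k%:~R).
  case: P => rs ss [/= szr Ht]; have [szs _ _] := tail_shape Ht.
  have := Ht => /tailP[_ _ step _ _].
  rewrite /tdeg /degree tail_degreeE // [(rs, ss).1]/= [(rs, ss).2]/= szr.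
  rewrite (_ : size (h (rs, ss)).2 = n); last by rewrite -szr -szs; apply: pincr_size.
  have -> : (\sum_(1 <= i < n) (n - i)%:R * weight p t (pr (h (rs, ss)) i.+1)
      (pr (h (rs, ss)) i) (pr (h (rs, ss)) i.-1)) = \sum_(1 <= i < n) (n - i)%:R *
      weight p t rs`_i (1 :: rs)`_i (2 :: 1 :: rs)`_i.
    by apply: eq_big_nat => -[|i].
  case: n {bij Ht} szr szs step => [|m] szr szs step.
    by rewrite !big_geq // big_ord0 !mul0r !addr0.
  have lt0 : (0 < size rs)%N by rewrite szr.
  have [/and3P[_ n2 e12] _] := step 0 lt0.
  have r2 : rs`_0 = 2 by move: n2 e12; rewrite /node /=; move: rs`_0 => u; lia.
  rewrite -(big_mkord xpredT (fun i => (m.+1 - i)%:R * (weight p t rs`_i (1 :: rs)`_i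
    (2 :: 1 :: rs)`_i + (ss`_i)%:~R))) [X in _ + X = _]big_nat_recl //
    [X in _ = X + _]big_nat_recl //.
  rewrite big_add1 /= subn0 r2 -/(turn_weight 2 1).
  have -> : psigma (h (rs, ss)) 0 = ss`_0 - k by rewrite /psigma /= pincr0 ?szs.
  under [X in _ = _ + X + _]eq_bigr => i _ do rewrite mulrDr.
  rewrite big_split /=.
  have -> : \sum_(0 <= i < m) (m.+1 - i.+1)%:R * (psigma (h (rs, ss)) i.+1)%:~R =
      \sum_(0 <= i < m) (m.+1 - i.+1)%:R * (ss`_i.+1)%:~R :> rat.
    by apply: eq_bigr => i _; rewrite /psigma /= pincr_nth.
  by ring.
rewrite /ch -gfE; last by apply: finite_below_bij bij deg _; apply: tails_finite.
by rewrite (gf_bij bij deg) //; apply: tails_finite.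
Qed.

End Tails.

(** * From level t - 1 to level t *)

(** Adding d to all weights multiplies the series by q to the power
    d * (1 + 2 + ... + (L - 1)). *)
Lemma transfer_shift (R : comNzRingType) (q : q_system R) p tau w w' v v' f F d :
  (forall a b, edge p a b -> w' a b = w a b + d) ->
  (forall a b, edge p a b -> v' a b = v a b) ->
  transfer q p tau w v f F ->
  transfer q p (tau + d) w' v' f
    (fun L a b k => q (d * (L%:R * (L%:R - 1) / 2)) * F L a b k).
Proof.
move=> wE vE [F0 F1 Fneg Fturn Ffree].
have qE L : q (d * (L.+1%:R * (L.+1%:R - 1) / 2)) =
    step_power q d L.+1 * q (d * (L%:R * (L%:R - 1) / 2)).
  by rewrite /step_power -qexpD -natr1; congr (q _); field.
split.
- by move=> a b k; rewrite F0 mulr0.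
- by move=> a b k; rewrite F1 (_ : d * _ = 0) ?qexp0 ?mul1r //; ring.
- by move=> L a b k k0; rewrite Fneg.
- move=> [|L] a b k ab k0; first by rewrite !F0 !mulr0 addr0.
  rewrite Fturn // wE // vE // mulrDr {2}qE /=.
  by rewrite (_ : w a b + d + k%:~R = d + (w a b + k%:~R)) ?step_powerD; ring.
- move=> [|L] a b k ab k0 vk; first by rewrite !F0 !mulr0 if_same addr0.
  rewrite mulrCA Ffree -?vE // wE // mulrDr !qE /=.
  rewrite (_ : w a b + d + k%:~R = d + (w a b + k%:~R)) ?step_powerD; last by ring.
  by case: ifP => _; rewrite ?step_powerD; ring.
Qed.

Section Level.
Variables (p : nat) (t : rat).
Hypothesis p3 : (3 <= p)%N.
Local Notation w := (turn_weight p t).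
Local Notation c := (turn_drop p).

Lemma turn_weight_up a b : edge p a b ->
  w a b = if is_end p a then 3 - 3 * t / 2
          else if b == a + 1 then 2 - t / 2 + (Num.floor (a%:~R * t))%:~R - a%:~R * t
          else 1 - t / 2 - (Num.floor (a%:~R * t))%:~R + a%:~R * t.
Proof.
rewrite /edge /node /is_end /turn_weight /weight eqxx /= => ab.
case: (b =P a + 1) => ba.
  by have -> : (a == 1) || (a == p%:Z - 1) = (a == 1) by lia.
by have -> : (a == 1) || (a == p%:Z - 1) = (a == p%:Z - 1) by lia.
Qed.

Lemma turn_weight_inner a b : edge p a b -> ~~ is_end p b ->
  w b a + w b (2 * b - a) = 3 - 2 * (t / 2).
Proof.
move=> ab bI; have bd := edge_next ab bI.
rewrite !turn_weight_up // 1?edgeC // (negPf bI).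
have [abE|abE] : a = b + 1 \/ a = b - 1 by move: ab; rewrite /edge; lia.
  by rewrite abE eqxx ifF; [lra|lia].
by rewrite abE ifF; [rewrite ifT; [lra|lia]|lia].
Qed.

Lemma vbound_edge a b : edge p a b ->
  vbound p t (Num.min a b) = 1 - w a b - w b a.
Proof.
rewrite /edge => /and3P[_ _ /orP[] /eqP ->].
  by rewrite (_ : Num.min a (a + 1) = a) ?/vbound //; lia.
rewrite (_ : Num.min a (a - 1) = a - 1) ?/vbound ?subrK; last by lia.
by rewrite /turn_weight; ring.
Qed.

(** Together with integrality this gives v >= -1. *)
Lemma vbound_gt (x : int) : 1 < t -> 1 <= x <= p%:Z - 2 -> - 2 < vbound p t x.
Proof.
move=> t1 xp; have ex : edge p x (x + 1) by rewrite /edge /node; lia.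
have -> : x = Num.min x (x + 1) by lia.
rewrite vbound_edge // !turn_weight_up // 1?edgeC // eqxx.
rewrite (_ : x == x + 1 + 1 = false); last by lia.
have /andP[f1 f2] := floor_itv (x%:~R * t).
have /andP[g1 g2] := floor_itv ((x + 1)%:~R * t).
rewrite /is_end; case: ifP => [e1|e1]; case: ifP => [e2|e2].
- by lra.
- have x1 : x = 1 by move: e1 e2; lia.
  by rewrite x1 in g1 g2 *; lra.
- by lra.
- by lra.
Qed.

(** The multiples of t in the two weights cancel, except next to p - 1, where they
    add up to p * t, an integer. *)
Lemma vbound_int (P : int) (x : int) : p%:R * t = P%:~R -> 1 <= x <= p%:Z - 2 ->
  (Num.floor (vbound p t x))%:~R = vbound p t x.
Proof.
move=> ptE xp; have ex : edge p x (x + 1) by rewrite /edge /node; lia.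
apply: floorK.
have -> : x = Num.min x (x + 1) by lia.
rewrite vbound_edge // !turn_weight_up // 1?edgeC // eqxx.
rewrite (_ : x == x + 1 + 1 = false); last by lia.
set f := Num.floor (x%:~R * t); set g := Num.floor ((x + 1)%:~R * t).
rewrite /is_end; case: ifP => [e1|e1]; case: ifP => [e2|e2].
- rewrite (_ : _ - _ = (P - 5)%:~R) ?intr_int // rmorphB /= -ptE.
  by rewrite (_ : p = 3); [lra|lia].
- rewrite (_ : _ - _ = (g - 3)%:~R) ?intr_int //.
  by rewrite (_ : x = 1); [lra|lia].
- rewrite (_ : _ - _ = (P - f - 4)%:~R) ?intr_int // !rmorphB /= -ptE.
  have xE : x%:~R = p%:R - 2 :> rat.
    by rewrite (_ : x = p%:Z - 2); [rewrite rmorphB /= -pmulrn | lia].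
  by rewrite xE; lra.
- by rewrite (_ : _ - _ = (g - f - 2)%:~R) ?intr_int //; lra.
Qed.

End Level.

Section TwoLevels.
Variables (p p' : nat) (t : rat).
Hypotheses (p3 : (3 <= p)%N) (tE : t = p'%:R / p%:R).
Local Notation w := (turn_weight p t).
Local Notation v := (turn_bound p t).
Local Notation c := (turn_drop p).

Lemma p_mul_t : p%:R * t = p'%:Z%:~R.
Proof. by rewrite tE mulrC divfK // pnatr_eq0; lia. Qed.

Lemma p_mul_t1 : p%:R * (t - 1) = (p'%:Z - p%:Z)%:~R.
Proof. by rewrite mulrBr p_mul_t mulr1 rmorphB. Qed.

(** As a is an integer, floor(a t) - a t is the same at both levels. *)
Lemma turn_weight_level a b : edge p a b ->
  w a b + (c a)%:~R = turn_weight p (t - 1) a b + 2^-1.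
Proof.
move=> ab; rewrite !turn_weight_up // /turn_drop.
have -> : Num.floor (a%:~R * (t - 1)) = Num.floor (a%:~R * t) - a.
  by rewrite mulrBr mulr1 floorDrz ?rpredN ?intr_int // -[- a%:~R]rmorphN intrKfloor.
by case: (is_end p a); [|case: ifP => _]; lra.
Qed.

Lemma turn_bound_edge a b : edge p a b -> w a b + w b a = 1 - (v a b)%:~R.
Proof.
move=> ab; rewrite /turn_bound (vbound_int p3 p_mul_t); first by rewrite vbound_edge; [lra|..].
by move: ab; rewrite /edge /node; lia.
Qed.

Lemma turn_bound_level a b : edge p a b ->
  v a b + 1 - c a - c b = turn_bound p (t - 1) a b.
Proof.
move=> ab; have ba : edge p b a by rewrite edgeC.
have xp : 1 <= Num.min a b <= p%:Z - 2 by move: ab; rewrite /edge /node; lia.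
apply: (@intr_inj rat); rewrite [in RHS]/turn_bound (vbound_int p3 p_mul_t1 xp).
have := turn_bound_edge ab; rewrite vbound_edge //.
by have := turn_weight_level ab; have := turn_weight_level ba; lra.
Qed.

Hypothesis t2 : 2 < t.

Lemma turn_bound_level_ge a b : edge p a b -> -1 <= v a b + 1 - c a - c b.
Proof.
move=> ab; have xp : 1 <= Num.min a b <= p%:Z - 2 by move: ab; rewrite /edge /node; lia.
rewrite turn_bound_level //; suff : -2 < turn_bound p (t - 1) a b by lia.
rewrite -(ltr_int rat) /turn_bound (vbound_int p3 p_mul_t1 xp).
by apply: vbound_gt => //; have := t2; lra.
Qed.

(** The shift by d = 1/2 makes the weight of straight steps agree with level t. *)
Definition lower_gf (r : int) (L : nat) (a b k : int) : lfseries :=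
  q_ (2^-1 * (L%:R * (L%:R - 1) / 2)) * tail_gf p (t - 1) r L a b k.

Lemma tail_gf_insertion (r : int) (L : nat) :
  tail_gf p t r L 2 1 (v 2 1) =
  insertion lf_system (3 * t / 2 - 4)
    (fun n => lower_gf r n 2 1 (turn_bound p (t - 1) 2 1 + 1)) L.
Proof.
have t_gt2 := t2; have e21 : edge p 2 1 by rewrite /edge /node; lia.
have e12 : edge p 1 2 by rewrite edgeC.
rewrite -(turn_bound_level e21).
have -> : 3 * t / 2 - 4 = 1 - (w 1 2 + (c 1)%:~R).
  have c1 : is_end p 1 by [].
  by rewrite (turn_weight_up _ p3 e12) /turn_drop c1; lra.
apply: (@transfer_insertion _ lf_system p (t / 2) w v
  (fun a b => v a b + 1 - c a - c b) (fun b => (b == r)%:R)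
  (tail_gf p t r) (lower_gf r)) => //.
- exact: turn_bound_edge.
- exact: turn_bound_level_ge.
- by move=> a b _; rewrite /turn_bound minC.
- by move=> a b ab bI; apply: turn_weight_inner.
- by apply: tail_transfer; lra.
rewrite (_ : t / 2 = (t - 1) / 2 + 2^-1); last by lra.
apply: transfer_shift (tail_transfer _ _ _) => //.
- exact: turn_weight_level.
- exact: turn_bound_level.
- by lra.
Qed.

End TwoLevels.

Lemma eq_coef (f g : lfseries) e : f = g -> coef f e = coef g e.
Proof. by move=> ->. Qed.

Lemma regroup a b a' b' x y (V T : lfseries) : a + b + a' + b' = x + y ->
  q_ a * (q_ b * V * q_ a' * (q_ b' * T)) = q_ x * V * (q_ y * T).
Proof.
move=> abxy; transitivity (q_ (a + b + a' + b') * V * T); first by rewrite !qD; ring.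
by rewrite abxy qD; ring.
Qed.

Theorem proposition3p3 (p p' : nat) (t : rat)
    (hp : (3 <= p)%N) (hp' : (0 < p')%N) (hpp' : coprime p p')
    (tE : t = p'%:R / p%:R) (ht : 2 < t)
    (r : int) (hr : 1 <= r <= p%:Z - 1) (L : nat) :
  ch p t L%:Z r =
  qsum [set: nat] (fun m : nat =>
    qmul (qmul (qpow (L%:R ^+ 2 / 4 + L%:R / 2)) (qinv (qpoch m)))
         (ch p (t - 1) (L%:Z - (2 * m)%:Z) r)).
Proof.
have e21 : edge p 2 1 by rewrite /edge /node; lia.
have e12 : edge p 1 2 by rewrite edgeC.
have end1 : is_end p 1 by [].
set v := turn_bound p t 2 1; set v' := turn_bound p (t - 1) 2 1.
have w12 : turn_weight p t 1 2 = 3 - 3 * t / 2 by rewrite turn_weight_up // end1.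
have vE : turn_weight p t 2 1 = 1 - v%:~R - turn_weight p t 1 2.
  by have := turn_bound_edge hp tE e21; rewrite -/v; lra.
have v'E := turn_bound_level hp tE e21; rewrite -/v -/v' {2}/turn_drop end1 in v'E.
have w'E : turn_weight p (t - 1) 2 1 = turn_weight p t 2 1 + (turn_drop p 2)%:~R - 2^-1.
  by have := turn_weight_level t hp e21; lra.
have v'1 : 0 <= v' + 1.
  by have := turn_bound_level_ge hp tE ht e21; rewrite (turn_bound_level hp tE e21) -/v'; lia.
have v0 : 0 <= v by move: v'E (c_ge1 p 2); lia.
have chE N : ch p (t - 1) N%:Z r =
    q_ (N%:R * (5 / 4 - 3 * t / 4)) * tail_gf p (t - 1) r N.+1 2 1 (v' + 1).
  rewrite (@Cset_start _ _ _ _ hp _ _ (v' + 1)) -/v' ?lerDl //; first last.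
  - by move=> x; apply: (vbound_int hp (p_mul_t1 hp tE)).
  - by lra.
  have -> : Delta21 (t - 1) - turn_weight p (t - 1) 2 1 - (v' + 1)%:~R = 5 / 4 - 3 * t / 4.
    by rewrite w'E -v'E vE w12 /Delta21; lra.
  by [].
have chN m : (L < 2 * m)%N -> ch p (t - 1) (L%:Z - (2 * m)%:Z) r = fun=> 0.
  move=> Lm; have -> : L%:Z - (2 * m)%:Z = Negz (2 * m - L).-1 by lia.
  by apply/funext => e; rewrite /ch /qsum fsbig_set0.
rewrite (@Cset_start _ _ _ _ hp _ _ v) //; first last.
- by move=> x; apply: (vbound_int hp (p_mul_t hp tE)).
- by lra.
rewrite (tail_gf_insertion hp tE ht) -/v' /insertion mulr_sumr.
apply/funext => e; rewrite lfcoef_sum /qsum (@fsum_seq _ _ (iota 0 L.+2)) ?iota_uniq //.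
  rewrite -[iota 0 _]/(index_iota 0 L.+2) big_mkord; apply: eq_bigr => m _.
  have [le_mL|lt_Lm] := leqP (2 * m) L; last first.
    rewrite chN // (_ : L.+1 - m.*2 = 0)%N; last by lia.
    by rewrite /lower_gf mulr0 mulr0 mulr0 /qmul fsbig1 // => x _; rewrite mulr0.
  have -> : L%:Z - (2 * m)%:Z = (L - 2 * m)%:Z by lia.
  rewrite chE (_ : L.+1 - m.*2 = (L - 2 * m).+1)%N; last by lia.
  rewrite -[qmul _ _]/(coef (q_ (L%:R ^+ 2 / 4 + L%:R / 2) * qpochV m * (q_ _ * _))).
  apply: eq_coef.
  rewrite /insertion_coef /lower_gf -[qexp lf_system]/q_ -[qfactV lf_system]/qpochV.
  apply: regroup; rewrite vE w12 /Delta21 -!natr1 natrB // natrM.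
  by field.
move=> m; apply: contraR; rewrite mem_iota add0n /= -leqNgt => le_Lm.
by rewrite chN; [rewrite /qmul fsbig1 // => x _; rewrite mulr0 | lia].
Qed.
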